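(* Let $0 < \varepsilon \leq 1/2$, $k$ be any positive integer, and $X \subseteq \mathbb{R}^d$ a dataset of $n$ points. There exists an algorithm in the SSAC framework that runs in time $O(n d k^9/\varepsilon^4)$ and with probability at least $\frac{1}{4}$ outputs a center set $C$ such that $\Phi(C, X) \leq (1 + \varepsilon) \cdot \Delta_k(X)$. Moreover, the number of same-cluster queries used by the algorithm is $O(k^9/\varepsilon^4)$.
   Context: $\Phi(C,X)=\sum_{x\in X}\min_{c\in C}\|x-c\|^2$; $\Delta_k(X)=\min_{|C|=k}\Phi(C,X)$ is the optimal $k$-means cost. In the SSAC framework a fixed optimal $k$-means clustering $X_1,\dots,X_k$ of $X$ is given implicitly, and the algorithm may ask same-cluster queries: for $x\neq y\in X$, whether $x,y$ belong to the same $X_i$. *)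

(* Defs.v *)
From HB Require Import structures.
From mathcomp Require Import all_boot all_order all_algebra.
From mathcomp Require Import boolp classical_sets reals.

Set Implicit Arguments.
Unset Strict Implicit.
Unset Printing Implicit Defensive.

Import Order.TTheory GRing.Theory Num.Theory.
Local Open Scope ring_scope.

(** * k-means *)

Section KMeans.
Variables (R : realType) (d : nat).

(* Squared Euclidean distance; the library norm on 'rV_d is the sup norm. *)
Definition sqdist (x c : 'rV[R]_d) : R := \sum_(j < d) (x 0 j - c 0 j) ^+ 2.

(* Center sets are duplicate-free sequences.  The default value of the minimum
   is one of its arguments whenever C is nonempty. *)
Definition mindist (C : seq 'rV[R]_d) (x : 'rV[R]_d) : R :=
  \big[Num.min/sqdist x (head 0 C)]_(c <- C) sqdist x c.

Definition Phi (n : nat) (C : seq 'rV[R]_d) (X : 'I_n -> 'rV[R]_d) : R :=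
  \sum_(i < n) mindist C (X i).

Definition Delta (n k : nat) (X : 'I_n -> 'rV[R]_d) : R :=
  inf [set v : R | exists C : seq 'rV[R]_d,
                     [/\ uniq C, size C = k & v = Phi C X]]%classic.

(* The clustering X_1, ..., X_k is given by its label function f, so that X_l is
   the fiber of f over l.  It is an optimal k-means clustering when it is the
   Voronoi partition (ties broken arbitrarily) of an optimal set of k centers. *)
Definition optimal_clustering (n k : nat) (X : 'I_n -> 'rV[R]_d)
    (f : 'I_n -> 'I_k) : Prop :=
  exists c : 'I_k -> 'rV[R]_d,
    [/\ injective c,
        Phi [seq c l | l : 'I_k] X = Delta k X
      & forall i l, sqdist (X i) (c (f i)) <= sqdist (X i) (c l)].

End KMeans.

(** * SSAC algorithms: programs of a randomized real RAM with a same-cluster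
    oracle

    The memory consists of arrays of natural numbers and arrays of reals, all
    initially zero outside of the input.  A program mentions finitely many
    arrays, by name, and every array is indexed by nat.  The syntax does not
    depend on the reals and only contains natural number constants, so that a
    program is a finite object, independent of the size of the input. *)

Inductive iexp : Type :=
| ICst of nat
| ILoad of nat & iexp            (* array name, index *)
| IAdd of iexp & iexp
| ISub of iexp & iexp            (* truncated *)
| IMul of iexp & iexp.

Inductive rexp : Type :=
| ROfI of iexp
| RLoad of nat & iexp            (* array name, index *)
| RAdd of rexp & rexp
| RSub of rexp & rexp
| RMul of rexp & rexp
| RDiv of rexp & rexp.           (* x / 0 = 0 *)

Inductive bexp : Type :=
| BLeI of iexp & iexp
| BLeR of rexp & rexp
| BNot of bexp
| BAnd of bexp & bexp.

(* In the last four commands the first two arguments are the name and the index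
   of the cell that is written. *)
Inductive cmd : Type :=
| Skip
| Seq of cmd & cmd
| If of bexp & cmd & cmd
| While of bexp & cmd
| IStore of nat & iexp & iexp
| RStore of nat & iexp & rexp
| Flip of nat & iexp & rexp          (* a coin with the given bias *)
| Query of nat & iexp & iexp & iexp. (* same-cluster query on two indices *)

Section Semantics.
Variable R : realType.

(* nqueries counts the queries made so far; programs cannot read it. *)
Record state : Type := State {
  imem : nat -> nat -> nat;
  rmem : nat -> nat -> R;
  nqueries : nat }.

Fixpoint ieval (s : state) (e : iexp) : nat :=
  match e with
  | ICst m => m
  | ILoad a i => imem s a (ieval s i)
  | IAdd e1 e2 => (ieval s e1 + ieval s e2)%N
  | ISub e1 e2 => (ieval s e1 - ieval s e2)%N
  | IMul e1 e2 => (ieval s e1 * ieval s e2)%N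
  end.

Fixpoint reval (s : state) (e : rexp) : R :=
  match e with
  | ROfI i => (ieval s i)%:R
  | RLoad a i => rmem s a (ieval s i)
  | RAdd e1 e2 => reval s e1 + reval s e2
  | RSub e1 e2 => reval s e1 - reval s e2
  | RMul e1 e2 => reval s e1 * reval s e2
  | RDiv e1 e2 => reval s e1 / reval s e2
  end.

Fixpoint beval (s : state) (b : bexp) : bool :=
  match b with
  | BLeI e1 e2 => (ieval s e1 <= ieval s e2)%N
  | BLeR e1 e2 => reval s e1 <= reval s e2
  | BNot b1 => ~~ beval s b1
  | BAnd b1 b2 => beval s b1 && beval s b2
  end.

Definition update (T : Type) (m : nat -> nat -> T) (a i : nat) (v : T) :
    nat -> nat -> T :=
  fun a' i' => if (a' == a) && (i' == i) then v else m a' i'.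

Definition set_int (s : state) (a i v : nat) : state :=
  State (update (imem s) a i v) (rmem s) (nqueries s).

Definition set_real (s : state) (a i : nat) (v : R) : state :=
  State (imem s) (update (rmem s) a i v) (nqueries s).

Definition add_query (s : state) : state :=
  State (imem s) (rmem s) (nqueries s).+1.

Definition clamp01 (p : R) : R := Num.min 1 (Num.max 0 p).

(* The commands that remain to be executed, and the current state. *)
Definition config : Type := (seq cmd * state)%type.

Variant transition : Type :=
| Halt of state
| Step of config
| Toss of R & config & config.   (* probability and target of heads; tails *)

Variable same_cluster : nat -> nat -> bool.

Definition next (cfg : config) : transition :=
  let: (K, s) := cfg in
  match K with
  | [::] => Halt s
  | Skip :: K' => Step (K', s)
  | Seq c1 c2 :: K' => Step (c1 :: c2 :: K', s)
  | If b c1 c2 :: K' => Step ((if beval s b then c1 else c2) :: K', s)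
  | While b c :: K' =>
      Step (if beval s b then c :: While b c :: K' else K', s)
  | IStore a i e :: K' => Step (K', set_int s a (ieval s i) (ieval s e))
  | RStore a i e :: K' => Step (K', set_real s a (ieval s i) (reval s e))
  | Flip a i p :: K' =>
      Toss (clamp01 (reval s p))
        (K', set_int s a (ieval s i) 1) (K', set_int s a (ieval s i) 0)
  | Query a i e1 e2 :: K' =>
      Step (K', set_int (add_query s) a (ieval s i)
                  (same_cluster (ieval s e1) (ieval s e2)))
  end.

(* Running time is the number of transitions.  The expressions of a given
   program have bounded size, so a transition is a bounded number of arithmetic
   operations, comparisons and memory accesses. *)

(* Whatever the outcomes of the coins, the machine halts within t transitions,
   in a state that satisfies Q. *)
Fixpoint always (t : nat) (cfg : config) (Q : state -> Prop) : Prop :=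
  match next cfg, t with
  | Halt s, _ => Q s
  | Step cfg', t'.+1 => always t' cfg' Q
  | Toss _ cfg1 cfg2, t'.+1 => always t' cfg1 Q /\ always t' cfg2 Q
  | _, 0 => False
  end.

(* The probability, over independent coins, that the machine halts within t
   transitions in a state that satisfies E. *)
Fixpoint Pr (t : nat) (cfg : config) (E : state -> Prop) : R :=
  match next cfg, t with
  | Halt s, _ => `[< E s >]%:R
  | Step cfg', t'.+1 => Pr t' cfg' E
  | Toss p cfg1 cfg2, t'.+1 => p * Pr t' cfg1 E + (1 - p) * Pr t' cfg2 E
  | _, 0 => 0
  end.

End Semantics.

(** * Input, oracle and output conventions *)

(* Queries are about two distinct points of X; any other query is answered
   negatively, which reveals nothing about the clustering. *)
Definition oracle (n k : nat) (f : 'I_n -> 'I_k) (i j : nat) : bool :=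
  (i != j) &&
  match insub i : option 'I_n, insub j : option 'I_n with
  | Some i', Some j' => f i' == f j'
  | _, _ => false
  end.

Section InputOutput.
Variables (R : realType) (n d k : nat).

(* Integer array 0 starts with n, d, k.  Real array 0 contains the coordinates
   of the points of X in row-major order and real array 2 starts with eps. *)
Definition init_state (eps : R) (X : 'I_n -> 'rV[R]_d) : state R :=
  State
    (fun a i => if a == 0 then nth 0 [:: n; d; k] i else 0)%N
    (fun a i =>
       if a == 0%N then
         nth 0 (flatten [seq [seq X p 0 j | j : 'I_d] | p : 'I_n]) i
       else if (a == 2)%N && (i == 0)%N then eps else 0)
    0.

(* The k centers are read from real array 1, in row-major order. *)
Definition output (s : state R) : seq 'rV[R]_d :=
  [seq \row_(j < d) rmem s 1 (l * d + j) | l : 'I_k].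

End InputOutput.

(* Main.v *)
Require Import Defs.
From mathcomp Require Import all_boot all_order all_algebra.
From mathcomp Require Import boolp classical_sets reals.
From mathcomp Require Import ring lra zify.

Set Implicit Arguments.
Unset Strict Implicit.
Unset Printing Implicit Defensive.

Import Order.TTheory GRing.Theory Num.Theory.
Local Open Scope ring_scope.

(** Let [c] be optimal centers, with clusters X_1, ..., X_k and cost OPT.

    Seeding. Starting from one point, draw 8k anchors by D^2-sampling. As long
    as the cost of the anchors exceeds 32 OPT, at least half of it lies in
    clusters whose own cost exceeds 16 times the optimum, and a D^2-sample in
    such a cluster repairs it with probability 1/2. Hence each round lowers the
    expected number of these clusters by 1/4, and after 8k rounds the anchors
    cost at most 32 OPT with probability 1/2.

    Recovery. Draw m = O(k^3 / eps^3) points with probability q(x) proportional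
    to D^2(x) / (total cost) + 1 / |cell of x|, where the cells are those of
    the anchors. Classify them by same-cluster queries against one
    representative per cluster and output the means weighted by 1 / q. If
    q(x) |X_j| >= zeta on all of X_j, Chebyshev's inequality shows that this
    mean is close to the mean of X_j. Otherwise some x in X_j is very close to an
    anchor whose cell is much larger than X_j; every center set that serves
    this cell well has a center near the anchor, and so does [c], so that c_j,
    which is the closest center to x, is near it too. X_j is then served well
    whatever has been sampled from it. *)

(** * Clusterings and their costs *)

Section SquaredDistance.
Variables (R : realType) (d : nat).
Implicit Types (x y z t c : 'rV[R]_d) (C : seq 'rV[R]_d).

Lemma sqdist_ge0 x y : 0 <= sqdist x y.
Proof. by apply: sumr_ge0 => j _; apply: sqr_ge0. Qed.

Lemma sqdistC x y : sqdist x y = sqdist y x.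
Proof. by apply: eq_bigr => j _; rewrite -sqrrN opprB. Qed.

Lemma sqdist_eq0 x y : (sqdist x y == 0) = (x == y).
Proof.
apply/idP/eqP => [|->]; last by apply/eqP/big1 => j _; rewrite subrr expr0n.
rewrite psumr_eq0 => [/allP coord_eq|j _]; last exact: sqr_ge0.
apply/rowP => j; apply/eqP; rewrite -subr_eq0 -sqrf_eq0.
exact: coord_eq (mem_index_enum j).
Qed.

Lemma sqdist_young (e : R) x y z : 0 < e ->
  sqdist x z <= (1 + e) * sqdist x y + (1 + e^-1) * sqdist y z.
Proof.
move=> e_gt0; rewrite /sqdist !mulr_sumr -big_split /=; apply: ler_sum => j _.
set u := x 0 j - y 0 j; set v := y 0 j - z 0 j.
have -> : x 0 j - z 0 j = u + v by rewrite addrA subrK.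
have : 0 <= e * (u - e^-1 * v) ^+ 2 by rewrite mulr_ge0 ?sqr_ge0 // ltW.
have -> : e * (u - e^-1 * v) ^+ 2 = e * u ^+ 2 - 2 * u * v + e^-1 * v ^+ 2.
  by field; rewrite gt_eqF.
lra.
Qed.

Lemma sqdist_triangle x y z : sqdist x z <= 2 * (sqdist x y + sqdist y z).
Proof. by have := sqdist_young x y z (@ltr01 R); rewrite invr1 -mulrDr. Qed.

Lemma sqdist_triangle3 x y z t :
  sqdist x t <= 3 * (sqdist x y + sqdist y z + sqdist z t).
Proof.
have half_gt0 : 0 < 2^-1 :> R by rewrite invr_gt0.
have := sqdist_young x y t (@ltr0Sn R 1); have := sqdist_triangle y z t.
rewrite (_ : 1 + 2^-1 = 3 / 2 :> R); lra.
Qed.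

Lemma mindist_le C x c : c \in C -> mindist C x <= sqdist x c.
Proof. by move=> cC; apply: bigmin_inf_seq cC _ _. Qed.

Lemma mindist_attained C x : C != [::] ->
  exists2 c, c \in C & mindist C x = sqdist x c.
Proof.
move=> C_neq0; rewrite /mindist big_seq.
apply: (big_ind (fun v => exists2 c, c \in C & v = sqdist x c)).
- by exists (head 0 C) => //; case: C C_neq0 => // c C _; apply: mem_head.
- by move=> v w v_att w_att; rewrite minEle; case: ifP.
- by move=> c cC; exists c.
Qed.

Lemma mindist_ge0 C x : C != [::] -> 0 <= mindist C x.
Proof. by move=> /(mindist_attained x)[c _ ->]; apply: sqdist_ge0. Qed.

Lemma Phi_ge0 n C (X : 'I_n -> 'rV[R]_d) : C != [::] -> 0 <= Phi C X.
Proof. by move=> C_neq0; apply: sumr_ge0 => i _; apply: mindist_ge0. Qed.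

End SquaredDistance.

Section Fibers.
Variables (R : realType) (I : finType) (T : eqType) (g : I -> T).

Definition fiber_size (p : T) : R := #|[pred x | g x == p]|%:R.

Lemma fiber_size_ge0 p : 0 <= fiber_size p.
Proof. exact: ler0n. Qed.

Lemma fiber_size_gt0 x : 0 < fiber_size (g x).
Proof. by rewrite ltr0n; apply/card_gt0P; exists x; rewrite inE. Qed.

Lemma sum_fiber_const p v : \sum_(x | g x == p) v = fiber_size p * v.
Proof. by rewrite sumr_const mulr_natl. Qed.

Lemma exists_le_average p x (F : I -> R) : g x = p ->
  exists y, fiber_size p * F y <= \sum_(z | g z == p) F z.
Proof.
move=> /eqP gx; have [y _ F_min] := arg_minP F (gx : [pred z | g z == p] x).
by exists y; rewrite -sum_fiber_const; apply: ler_sum => z /F_min.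
Qed.

End Fibers.

Section Clusters.
Variables (R : realType) (d : nat) (I J : finType).
Variables (X : I -> 'rV[R]_d) (g : I -> J).
Implicit Types (j : J) (y z : 'rV[R]_d) (c : J -> 'rV[R]_d).

Local Notation N := (fiber_size R g).

Definition cluster_cost j y : R := \sum_(i | g i == j) sqdist (X i) y.

Definition cost c : R := \sum_i sqdist (X i) (c (g i)).

Definition centroid j : 'rV[R]_d := (N j)^-1 *: \sum_(i | g i == j) X i.

Lemma cluster_cost_ge0 j y : 0 <= cluster_cost j y.
Proof. by apply: sumr_ge0 => i _; apply: sqdist_ge0. Qed.

Lemma cost_ge0 c : 0 <= cost c.
Proof. by apply: sumr_ge0 => i _; apply: sqdist_ge0. Qed.

Lemma cost_clusters c : cost c = \sum_j cluster_cost j (c j).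
Proof.
rewrite /cost (partition_big g predT) //=.
by apply: eq_bigr => j _; apply: eq_bigr => i /eqP ->.
Qed.

Lemma sum_centroid j a : \sum_(i | g i == j) X i 0 a = N j * centroid j 0 a.
Proof.
have [N0|N_neq0] := eqVneq (N j) 0; last by rewrite mxE summxE mulVKf.
move/eqP: (N0); rewrite pnatr_eq0 => /eqP/card0_eq fiber0.
by rewrite N0 mul0r big_pred0.
Qed.

Lemma cluster_cost_centroid j y :
  cluster_cost j y = cluster_cost j (centroid j) + N j * sqdist (centroid j) y.
Proof.
rewrite /cluster_cost /sqdist exchange_big [X in X + _]exchange_big /=.
rewrite mulr_sumr -big_split /=; apply: eq_bigr => a _.
set m := centroid j 0 a; set t := y 0 a.
transitivity (\sum_(i | g i == j)
    ((X i 0 a - m) ^+ 2 + 2 * (m - t) * X i 0 a + (t ^+ 2 - m ^+ 2))).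
  by apply: eq_bigr => i _; ring.
by rewrite 2!big_split /= -mulr_sumr sum_centroid sum_fiber_const -/m; ring.
Qed.

Lemma cluster_cost_centroid_le j y :
  cluster_cost j (centroid j) <= cluster_cost j y.
Proof.
by rewrite [leRHS]cluster_cost_centroid lerDl mulr_ge0
  ?fiber_size_ge0 ?sqdist_ge0.
Qed.

Lemma sum_cluster_cost_points j :
  \sum_(a | g a == j) cluster_cost j (X a) =
  2 * N j * cluster_cost j (centroid j).
Proof.
under eq_bigr => a _ do rewrite cluster_cost_centroid sqdistC.
by rewrite big_split /= sum_fiber_const -mulr_sumr -/(cluster_cost _ _); ring.
Qed.

Lemma cluster_cost_young u j y z : 0 < u ->
  cluster_cost j z <=
  (1 + u) * cluster_cost j y + (1 + u^-1) * (N j * sqdist y z).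
Proof.
move=> u_gt0; rewrite mulrCA -sum_fiber_const mulr_sumr -big_split /=.
by apply: ler_sum => i _; apply: sqdist_young.
Qed.

End Clusters.

Lemma sum_markov (R : realType) (I : finType) (P : pred I) (p F : I -> R)
    (t s : R) :
  (forall i, 0 <= p i) -> (forall i, 0 <= F i) -> 0 <= t -> 0 <= s ->
  \sum_(i | P i) p i * F i <= t * s ->
  \sum_(i | P i) p i * (2 * t < F i)%R%:R <= s / 2.
Proof.
move=> p_ge0 F_ge0 t_ge0 s_ge0 sum_le.
have pF_ge0 i : P i -> 0 <= p i * F i by move=> _; apply: mulr_ge0.
have [t0|t_neq0] := eqVneq t 0.
  rewrite t0 mul0r in sum_le; rewrite big1 ?divr_ge0 // => i Pi.
  have /eqP : p i * F i = 0.
    apply: (psumr_eq0P pF_ge0) Pi; apply/le_anti.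
    by rewrite sum_le sumr_ge0.
  by rewrite t0 mulr0 mulf_eq0 => /orP[] /eqP ->; rewrite ?mul0r ?ltxx ?mulr0.
have t_gt0 : 0 < 2 * t by rewrite mulr_gt0 // lt_def t_neq0.
rewrite -(ler_pM2l t_gt0) mulr_sumr.
apply: (@le_trans _ _ (\sum_(i | P i) p i * F i)); last lra.
apply: ler_sum => i _; rewrite mulrCA ler_wpM2l //.
by case: ltP => [/ltW|_]; rewrite ?mulr1 ?mulr0.
Qed.

(** * Expectations over random sequences *)

Section Chains.
Variables (R : realType) (I : finType) (S : Type).
Variables (law : S -> I -> R) (move_to : S -> I -> S).
Implicit Types (s : S) (h : S -> R) (xs : seq I).

Fixpoint chain_expect m h s : R :=
  if m is m'.+1 then \sum_a law s a * chain_expect m' h (move_to s a) else h s.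

Local Notation E := chain_expect.

Lemma chain_expectZ m v h s : E m (fun s' => v * h s') s = v * E m h s.
Proof.
elim: m s => //= m IH s; rewrite mulr_sumr.
by apply: eq_bigr => a _; rewrite IH mulrCA.
Qed.

Lemma chain_expect_sum (T : Type) (r : seq T) (P : pred T) m
    (h : T -> S -> R) s :
  E m (fun s' => \sum_(j <- r | P j) h j s') s =
  \sum_(j <- r | P j) E m (h j) s.
Proof.
elim: m s => //= m IH s; rewrite exchange_big /=.
by apply: eq_bigr => a _; rewrite IH mulr_sumr.
Qed.

Lemma chain_expectD m h1 h2 s :
  E m (fun s' => h1 s' + h2 s') s = E m h1 s + E m h2 s.
Proof.
elim: m s => //= m IH s; rewrite -big_split /=.
by apply: eq_bigr => a _; rewrite IH mulrDr.
Qed.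

Hypothesis law_ge0 : forall s a, 0 <= law s a.

Lemma chain_expect_ge0 m h s : (forall s', 0 <= h s') -> 0 <= E m h s.
Proof.
move=> h_ge0; elim: m s => //= m IH s.
by apply: sumr_ge0 => a _; rewrite mulr_ge0.
Qed.

Hypothesis law_sum : forall s, \sum_a law s a = 1.

Lemma chain_expect_const m v s : E m (fun=> v) s = v.
Proof.
elim: m s => //= m IH s.
by under eq_bigr => a _ do rewrite IH; rewrite -mulr_suml law_sum mul1r.
Qed.

Lemma le_chain_expect m h1 h2 s :
  (forall xs, size xs = m ->
     h1 (foldl move_to s xs) <= h2 (foldl move_to s xs)) ->
  E m h1 s <= E m h2 s.
Proof.
elim: m s => [|m IH] s le_h /=; first exact: (le_h [::]).
apply: ler_sum => a _; apply: ler_wpM2l => //; apply: IH => xs sz_xs.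
by apply: (le_h (a :: xs)); rewrite /= sz_xs.
Qed.

Lemma chain_expect_drift (inv : S -> Prop) (good : pred S) (phi : S -> R)
    delta m s :
  (forall s a, inv s -> inv (move_to s a)) ->
  (forall s a, good s -> good (move_to s a)) ->
  (forall s, 0 <= phi s) -> 0 <= delta ->
  (forall s, inv s -> ~~ good s ->
     \sum_a law s a * phi (move_to s a) <= phi s - delta) ->
  inv s -> delta * m%:R * E m (fun s' => (~~ good s')%:R) s <= phi s.
Proof.
move=> inv_move good_move phi_ge0 delta_ge0 drift.
have good_foldl xs s' : good s' -> good (foldl move_to s' xs).
  by elim: xs s' => //= a xs IH s' /(good_move _ a)/IH.
elim: m s => [|m IH] s inv_s; first by rewrite mulr0 mul0r.
have [good_s|bad_s] := boolP (good s).
  apply: le_trans (phi_ge0 s); rewrite mulr_ge0_le0 ?mulr_ge0 //.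
  rewrite -[leRHS](chain_expect_const m.+1 0 s).
  by apply: le_chain_expect => xs _; rewrite good_foldl.
have E_le1 : E m.+1 (fun s' => (~~ good s')%:R) s <= 1.
  rewrite -[leRHS](chain_expect_const m.+1 1 s).
  by apply: le_chain_expect => xs _; rewrite lern1 leq_b1.
have phi_next : delta * m%:R * E m.+1 (fun s' => (~~ good s')%:R) s <=
    \sum_a law s a * phi (move_to s a).
  rewrite /= mulr_sumr; apply: ler_sum => a _.
  by rewrite mulrCA ler_wpM2l // IH //; apply: inv_move.
have := drift s inv_s bad_s; have := ler_wpM2l delta_ge0 E_le1.
by rewrite -natr1; lra.
Qed.

Lemma chain_expect_success (good : pred S) p m v s :
  0 <= p -> (forall s', 0 <= v s') ->
  (forall xs (s' := foldl move_to s xs), size xs = m -> good s' -> p <= v s') ->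
  p * (1 - E m (fun s' => (~~ good s')%:R) s) <= E m v s.
Proof.
move=> p_ge0 v_ge0 p_le; rewrite mulrBr mulr1 -mulrN -mulN1r.
rewrite -chain_expectZ -[X in X + _](chain_expect_const m p s) -chain_expectZ.
rewrite -chain_expectD; apply: le_chain_expect => xs /p_le.
by case: (good _) => [/(_ isT)|_]; rewrite ?mulr0 ?addr0 // mulr1 mulrN1 subrr.
Qed.

End Chains.

Section IndependentSamples.
Variables (R : realType) (I : finType) (q : I -> R).
Hypothesis q_sum : \sum_a q a = 1.

Definition push (xs : seq I) (a : I) : seq I := a :: xs.

Lemma size_foldl_push xs ys : size (foldl push xs ys) = (size ys + size xs)%N.
Proof. by elim: ys xs => //= a ys IH xs; rewrite IH /= addnS. Qed.

Definition iid_expect : nat -> (seq I -> R) -> seq I -> R :=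
  chain_expect (fun=> q) push.

Lemma iid_expect_sqr_sum m (h : I -> R) xs : \sum_a q a * h a = 0 ->
  iid_expect m (fun ys => (\sum_(y <- ys) h y) ^+ 2) xs =
  (\sum_(x <- xs) h x) ^+ 2 + m%:R * \sum_a q a * h a ^+ 2.
Proof.
rewrite /iid_expect => h0.
elim: m xs => [|m IH] xs /=; first by rewrite mul0r addr0.
under eq_bigr => a _ do rewrite IH big_cons.
set A := \sum_(x <- xs) h x; set V := \sum_a q a * h a ^+ 2.
transitivity (\sum_a (q a * h a ^+ 2 + (2 * A * (q a * h a)
   + (A ^+ 2 + m%:R * V) * q a))).
  by apply: eq_bigr => a _; ring.
by rewrite !big_split /= -!mulr_sumr h0 q_sum -/V -natr1; ring.
Qed.

Lemma mean_centered (h : I -> R) : \sum_a q a * (h a - \sum_b q b * h b) = 0.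
Proof.
under eq_bigr => a _ do rewrite mulrBr.
by rewrite sumrB -mulr_suml q_sum mul1r subrr.
Qed.

Lemma variance_le (h : I -> R) :
  \sum_a q a * (h a - \sum_b q b * h b) ^+ 2 <= \sum_a q a * h a ^+ 2.
Proof.
set e := \sum_b q b * h b.
have -> : \sum_a q a * (h a - e) ^+ 2 = \sum_a q a * h a ^+ 2 - e ^+ 2.
  transitivity (\sum_a
      (q a * h a ^+ 2 + (- 2 * e * (q a * h a) + e ^+ 2 * q a))).
    by apply: eq_bigr => a _; ring.
  by rewrite !big_split /= -!mulr_sumr q_sum -/e; ring.
by rewrite gerBl sqr_ge0.
Qed.

End IndependentSamples.

Section SampleLaw.
Variables (R : realType) (I : finType) (i0 : I) (w : I -> R).

(* The law of the sampling procedure below, whose initial choice [i0] survives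
   if all weights vanish. *)
Definition sample_law (x : I) : R :=
  if \sum_i w i == 0 then (x == i0)%:R else w x / \sum_i w i.

Lemma sample_law_ge0 x : (forall i, 0 <= w i) -> 0 <= sample_law x.
Proof.
move=> w_ge0; rewrite /sample_law; case: ifP => // _.
by rewrite divr_ge0 // sumr_ge0.
Qed.

Lemma sample_law_sum : \sum_x sample_law x = 1.
Proof.
rewrite /sample_law; case: eqP => [_|/eqP sum_neq0].
  by rewrite (bigD1 i0) //= eqxx big1 ?addr0 // => x /negbTE ->.
by rewrite -mulr_suml divff.
Qed.

End SampleLaw.

(** * Seeding by D^2-sampling *)

Section Seeding.
Variables (R : realType) (d : nat) (I J : finType).
Variables (X : I -> 'rV[R]_d) (f : I -> J) (c : J -> 'rV[R]_d) (i0 : I).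
Implicit Types (b : I -> I) (a x y : I) (j : J).

Definition anchor_dist b x : R := sqdist (X x) (X (b x)).
Definition anchor_cost b : R := \sum_x anchor_dist b x.
Definition anchor_cost_in b j : R := \sum_(x | f x == j) anchor_dist b x.

Definition add_anchor b a x : I :=
  if sqdist (X x) (X a) <= anchor_dist b x then a else b x.

Definition nearest_anchor b : Prop :=
  forall x y, anchor_dist b x <= sqdist (X x) (X (b y)).

Lemma anchor_dist_ge0 b x : 0 <= anchor_dist b x.
Proof. exact: sqdist_ge0. Qed.

Lemma anchor_cost_ge0 b : 0 <= anchor_cost b.
Proof. by apply: sumr_ge0 => x _; apply: anchor_dist_ge0. Qed.

Lemma anchor_cost_in_ge0 b j : 0 <= anchor_cost_in b j.
Proof. by apply: sumr_ge0 => x _; apply: anchor_dist_ge0. Qed.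

Lemma anchor_dist_add b a x :
  anchor_dist (add_anchor b a) x =
  Num.min (sqdist (X x) (X a)) (anchor_dist b x).
Proof. by rewrite minEle /anchor_dist /add_anchor; case: ifP. Qed.

Lemma anchor_dist_add_le b a x :
  anchor_dist (add_anchor b a) x <= anchor_dist b x.
Proof. by rewrite anchor_dist_add ge_min lexx orbT. Qed.

Lemma anchor_cost_add b a : anchor_cost (add_anchor b a) <= anchor_cost b.
Proof. by apply: ler_sum => x _; apply: anchor_dist_add_le. Qed.

Lemma anchor_cost_in_add b a j :
  anchor_cost_in (add_anchor b a) j <= anchor_cost_in b j.
Proof. by apply: ler_sum => x _; apply: anchor_dist_add_le. Qed.

Lemma anchor_cost_in_add_new b a j :
  anchor_cost_in (add_anchor b a) j <= cluster_cost X f j (X a).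
Proof. by apply: ler_sum => x _; rewrite anchor_dist_add ge_min lexx. Qed.

Lemma nearest_anchor_add b a :
  nearest_anchor b -> nearest_anchor (add_anchor b a).
Proof.
move=> b_near x y; rewrite {2}/add_anchor anchor_dist_add.
by case: ifP => _; rewrite ge_min ?lexx ?b_near ?orbT.
Qed.

Lemma foldl_add_anchor_mem b xs x : foldl add_anchor b xs x \in b x :: xs.
Proof.
elim: xs b => [|a xs IH] b; first by rewrite mem_head.
have := IH (add_anchor b a); rewrite /= !inE [add_anchor b a x]/add_anchor.
by case: ifP => _ /orP[->|->]; rewrite ?orbT.
Qed.

Lemma anchor_dist_le_average b a j : nearest_anchor b ->
  fiber_size R f j * anchor_dist b a <=
  2 * (anchor_cost_in b j + cluster_cost X f j (X a)).
Proof.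
move=> b_near; rewrite -sum_fiber_const -big_split mulr_sumr /=.
apply: ler_sum => y _; apply: le_trans (b_near a y) _.
by rewrite addrC (sqdistC (X y)); apply: sqdist_triangle.
Qed.

Lemma expected_anchor_cost_in b j : nearest_anchor b ->
  \sum_(a | f a == j) anchor_dist b a * anchor_cost_in (add_anchor b a) j <=
  8 * cluster_cost X f j (centroid X f j) * anchor_cost_in b j.
Proof.
move=> b_near; set A := anchor_cost_in b j; set V := cluster_cost X f j _.
have A_ge0 : 0 <= A := anchor_cost_in_ge0 b j.
have [x /eqP fx|fiber0] := pickP (fun x => f x == j); last first.
  by rewrite big_pred0 // !mulr_ge0 ?cluster_cost_ge0.
have N_gt0 : 0 < fiber_size R f j by rewrite -fx fiber_size_gt0.
rewrite -(ler_pM2l N_gt0) mulr_sumr.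
apply: (@le_trans _ _ (\sum_(a | f a == j) 4 * A * cluster_cost X f j (X a))).
  apply: ler_sum => a _; rewrite mulrA; set A' := anchor_cost_in _ j.
  have A'_ge0 : 0 <= A' := anchor_cost_in_ge0 _ j.
  have avg := ler_wpM2r A'_ge0 (anchor_dist_le_average a j b_near).
  have := ler_wpM2l A_ge0 (anchor_cost_in_add_new b a j).
  have := ler_wpM2l (cluster_cost_ge0 X f j (X a)) (anchor_cost_in_add b a j).
  rewrite -/A -/A' in avg *; lra.
by rewrite -mulr_sumr sum_cluster_cost_points -/V; lra.
Qed.

Definition uncovered b j : bool :=
  16 * cluster_cost X f j (c j) < anchor_cost_in b j.

Definition nuncovered b : R := \sum_j (uncovered b j)%:R.

Lemma uncovered_add b a j : uncovered (add_anchor b a) j -> uncovered b j.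
Proof. by move=> /lt_le_trans; apply; apply: anchor_cost_in_add. Qed.

Lemma sample_covers_half b j : nearest_anchor b ->
  anchor_cost_in b j / 2 <=
  \sum_(a | f a == j) anchor_dist b a * (~~ uncovered (add_anchor b a) j)%:R.
Proof.
move=> b_near; set opt := cluster_cost X f j (c j).
have markov : \sum_(a | f a == j) anchor_dist b a *
    (uncovered (add_anchor b a) j)%:R <= anchor_cost_in b j / 2.
  have := @sum_markov R I (fun a => f a == j) (anchor_dist b)
    (fun a => anchor_cost_in (add_anchor b a) j) (8 * opt) (anchor_cost_in b j).
  rewrite mulrA -natrM; apply=> [a|a|||].
  - exact: anchor_dist_ge0.
  - exact: anchor_cost_in_ge0.
  - by rewrite mulr_ge0 ?cluster_cost_ge0.
  - exact: anchor_cost_in_ge0.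
  - apply: le_trans (expected_anchor_cost_in j b_near) _.
    rewrite ler_wpM2r ?anchor_cost_in_ge0 //.
    by rewrite ler_wpM2l ?cluster_cost_centroid_le.
suff -> : \sum_(a | f a == j)
      anchor_dist b a * (~~ uncovered (add_anchor b a) j)%:R =
    anchor_cost_in b j - \sum_(a | f a == j)
      anchor_dist b a * (uncovered (add_anchor b a) j)%:R by lra.
rewrite -sumrB; apply: eq_bigr => a _.
by case: uncovered; rewrite ?mulr1 ?mulr0 ?subrr ?subr0.
Qed.

Lemma nuncovered_add b a : nuncovered (add_anchor b a) <=
  nuncovered b - (uncovered b (f a) && ~~ uncovered (add_anchor b a) (f a))%:R.
Proof.
rewrite /nuncovered (bigD1 (f a)) //= [X in X - _](bigD1 (f a)) //= addrAC.
apply: lerD; last first.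
  apply: ler_sum => j _; rewrite ler_nat.
  by have := @uncovered_add b a j; case: uncovered => // ->.
by have := @uncovered_add b a (f a); do 2!case: uncovered => //=;
  rewrite ?subrr ?subr0 // => /(_ isT).
Qed.

Lemma uncovered_cost b : 32 * cost X f c <= anchor_cost b ->
  anchor_cost b / 2 <= \sum_(j | uncovered b j) anchor_cost_in b j.
Proof.
have covered_cost :
    \sum_(j | ~~ uncovered b j) anchor_cost_in b j <= 16 * cost X f c.
  rewrite cost_clusters mulr_sumr [leRHS](bigID (uncovered b)) /= addrC.
  rewrite ler_wpDr ?sumr_ge0 // => [j _|].
    by rewrite mulr_ge0 ?cluster_cost_ge0.
  by apply: ler_sum => j; rewrite -leNgt.
have -> : anchor_cost b = \sum_(j | uncovered b j) anchor_cost_in b j +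
    \sum_(j | ~~ uncovered b j) anchor_cost_in b j.
  by rewrite /anchor_cost (partition_big f predT) //= (bigID (uncovered b)).
lra.
Qed.

Lemma seeding_law_ge0 b a : 0 <= sample_law i0 (anchor_dist b) a.
Proof. by apply: sample_law_ge0 => x; apply: anchor_dist_ge0. Qed.

Lemma expected_nuncovered b :
  nearest_anchor b -> ~~ (anchor_cost b <= 32 * cost X f c) ->
  \sum_a sample_law i0 (anchor_dist b) a * nuncovered (add_anchor b a) <=
  nuncovered b - 4^-1.
Proof.
rewrite -ltNge => b_near big_cost.
have A_gt0 : 0 < anchor_cost b.
  by apply: le_lt_trans big_cost; rewrite mulr_ge0 ?cost_ge0.
have lawE a : sample_law i0 (anchor_dist b) a = anchor_dist b a / anchor_cost b.
  by rewrite /sample_law -/(anchor_cost b) gt_eqF.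
pose covers a := uncovered b (f a) && ~~ uncovered (add_anchor b a) (f a).
apply: (@le_trans _ _ (\sum_a sample_law i0 (anchor_dist b) a *
    (nuncovered b - (covers a)%:R))).
  by apply: ler_sum => a _; rewrite ler_wpM2l ?nuncovered_add ?seeding_law_ge0.
under eq_bigr => a _ do rewrite mulrBr.
rewrite sumrB -mulr_suml sample_law_sum mul1r lerD2l lerN2.
under eq_bigr => a _ do rewrite lawE mulrAC.
rewrite -mulr_suml ler_pdivlMr //.
apply: (@le_trans _ _ (\sum_(j | uncovered b j) anchor_cost_in b j / 2)).
  by rewrite -mulr_suml; have := uncovered_cost (ltW big_cost); lra.
rewrite (partition_big f predT) //= [leRHS](bigID (uncovered b)) /=.
rewrite ler_wpDr ?sumr_ge0 // => [j _|].
  by apply: sumr_ge0 => a _; rewrite mulr_ge0 ?anchor_dist_ge0.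
apply: ler_sum => j unc_j; apply: le_trans (sample_covers_half j b_near) _.
by apply: ler_sum => a /eqP fa; rewrite /covers fa unc_j.
Qed.

Lemma nuncovered_le b : nuncovered b <= #|J|%:R.
Proof.
by rewrite -sumr_const; apply: ler_sum => j _; rewrite lern1 leq_b1.
Qed.

Definition seeding_expect (m : nat) (h : (I -> I) -> R) : R :=
  chain_expect (fun b => sample_law i0 (anchor_dist b)) add_anchor m h
    (fun=> i0).

Lemma seeding_failure : (0 < #|J|)%N ->
  seeding_expect (8 * #|J|)
    (fun b => (~~ (anchor_cost b <= 32 * cost X f c))%:R) <= 2^-1.
Proof.
move=> J_gt0; have k_gt0 : 0 < #|J|%:R :> R by rewrite ltr0n.
set e := seeding_expect _ _.
suff : 4^-1 * (8 * #|J|)%:R * e <= #|J|%:R.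
  by rewrite natrM => bound; rewrite -(ler_pM2l k_gt0); lra.
apply: le_trans (nuncovered_le (fun=> i0)).
apply: (chain_expect_drift seeding_law_ge0
  (fun b => sample_law_sum i0 (anchor_dist b)) (inv := nearest_anchor)) => //.
- by move=> b a; apply: nearest_anchor_add.
- by move=> b a; apply: le_trans (anchor_cost_add b a).
- by move=> b; apply: sumr_ge0.
- by rewrite invr_ge0.
- exact: expected_nuncovered.
Qed.

Lemma seeding_success p v :
  0 <= p -> (0 < #|J|)%N -> (forall b, 0 <= v b) ->
  (forall xs (b := foldl add_anchor (fun=> i0) xs), size xs = (8 * #|J|)%N ->
     anchor_cost b <= 32 * cost X f c -> p <= v b) ->
  p / 2 <= seeding_expect (8 * #|J|) v.
Proof.
move=> p_ge0 J_gt0 v_ge0 p_le.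
apply: le_trans (chain_expect_success seeding_law_ge0
  (fun b => sample_law_sum i0 (anchor_dist b)) p_ge0 v_ge0 p_le).
rewrite ler_wpM2l //; have := seeding_failure J_gt0.
by rewrite /seeding_expect; lra.
Qed.

End Seeding.

(** * Estimating centroids by importance sampling *)

Section CentroidEstimation.
Variables (R : realType) (d : nat) (I J : finType).
Variables (X : I -> 'rV[R]_d) (f : I -> J).
Implicit Types (w : I -> R) (j : J) (xs : seq I) (delta : R).

Local Notation N := (fiber_size R f).
Local Notation mu := (centroid X f).

Definition weighted_mean w xs j : 'rV[R]_d :=
  (\sum_(x <- xs | f x == j) (w x)^-1)^-1 *:
  \sum_(x <- xs | f x == j) (w x)^-1 *: X x.

Lemma weighted_mean_scale s w xs j : s != 0 ->
  weighted_mean (fun x => w x / s) xs j = weighted_mean w xs j.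
Proof.
move=> s_neq0; rewrite /weighted_mean.
under eq_bigr => x _ do rewrite invf_div.
under [X in _ *: X]eq_bigr => x _ do rewrite invf_div -scalerA.
by rewrite -mulr_sumr -scaler_sumr invfM scalerA mulrAC mulVf // mul1r.
Qed.

Variables (q : I -> R) (zeta : R) (m : nat).
Hypothesis q_gt0 : forall x, 0 < q x.
Hypothesis q_sum : \sum_x q x = 1.
Hypothesis zeta_gt0 : 0 < zeta.
Hypothesis m_gt0 : (0 < m)%N.

Local Notation E h := (iid_expect q m h [::]).

Definition heavy j : bool :=
  (0 < N j) && [forall (x | f x == j), zeta <= q x * N j].

Definition hit j x : R := (f x == j)%:R / q x.

Lemma expected_hit j (F : I -> R) :
  \sum_x q x * (hit j x * F x) = \sum_(x | f x == j) F x.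
Proof.
rewrite [RHS]big_mkcond /=; apply: eq_bigr => x _; rewrite /hit.
case: eqP => _; last by rewrite !mul0r mulr0.
by rewrite div1r mulVKf // gt_eqF.
Qed.

Lemma expected_hit1 j : \sum_x q x * hit j x = N j.
Proof.
rewrite -[RHS]mulr1 -sum_fiber_const -expected_hit.
by under [RHS]eq_bigr => x _ do rewrite mulr1.
Qed.

Lemma expected_hit_sqr_le j (F : I -> R) : heavy j -> (forall x, 0 <= F x) ->
  \sum_x q x * (hit j x ^+ 2 * F x) <= N j / zeta * \sum_(x | f x == j) F x.
Proof.
move=> /andP[N_gt0 /forallP q_ge] F_ge0.
under eq_bigr => x _ do rewrite expr2 -mulrA.
rewrite (expected_hit j (fun x => hit j x * F x)) mulr_sumr.
apply: ler_sum => x fx; rewrite ler_wpM2r // /hit fx.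
have := q_ge x; rewrite fx /= => q_ge_x.
by rewrite ler_pdivrMr // mulrAC ler_pdivlMr // mul1r mulrC.
Qed.

Definition size_error j xs : R :=
  (\sum_(x <- xs) (hit j x - N j)) / (m%:R * N j).

Definition mean_error j a xs : R :=
  (\sum_(x <- xs) hit j x * (X x 0 a - mu j 0 a)) / (m%:R * N j).

Lemma expected_sqr_average (h : I -> R) v : \sum_x q x * h x = 0 ->
  E (fun xs => ((\sum_(x <- xs) h x) / (m%:R * v)) ^+ 2) =
  (\sum_x q x * h x ^+ 2) / (m%:R * v ^+ 2).
Proof.
move=> h_centered; under eq_fun => xs do rewrite expr_div_n mulrC.
rewrite /iid_expect chain_expectZ -/(iid_expect _ _) iid_expect_sqr_sum //.
rewrite big_nil expr0n add0r mulrC exprMn.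
have [->|v_neq0] := eqVneq v 0; first by rewrite expr0n !mulr0 invr0 !mulr0.
by field; rewrite v_neq0 pnatr_eq0 -lt0n.
Qed.

Lemma expected_size_error j : heavy j ->
  E (fun xs => size_error j xs ^+ 2) <= (m%:R * zeta)^-1.
Proof.
move=> j_heavy; have /andP[N_gt0 _] := j_heavy.
have m_pos : 0 < m%:R :> R by rewrite ltr0n.
rewrite expected_sqr_average; last first.
  by rewrite -[RHS](mean_centered q_sum (hit j)) expected_hit1.
rewrite ler_pdivrMr ?mulr_gt0 ?exprn_gt0 //.
have -> : (m%:R * zeta)^-1 * (m%:R * N j ^+ 2) = N j / zeta * N j.
  by field; rewrite !gt_eqF.
have := variance_le q_sum (hit j); rewrite expected_hit1 => /le_trans; apply.
have := expected_hit_sqr_le j_heavy (fun=> ler01).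
rewrite sum_fiber_const mulr1; apply: le_trans.
by under [leRHS]eq_bigr => x _ do rewrite mulr1.
Qed.

Lemma deviation_centered j a :
  \sum_x q x * (hit j x * (X x 0 a - mu j 0 a)) = 0.
Proof.
by rewrite (expected_hit j (fun x => X x 0 a - mu j 0 a)) sumrB sum_centroid
  sum_fiber_const subrr.
Qed.

Lemma expected_mean_error j : heavy j ->
  E (fun xs => N j * \sum_a mean_error j a xs ^+ 2) <=
  cluster_cost X f j (mu j) / (m%:R * zeta).
Proof.
move=> j_heavy; have /andP[N_gt0 _] := j_heavy.
have m_pos : 0 < m%:R :> R by rewrite ltr0n.
rewrite /iid_expect chain_expectZ chain_expect_sum -/(iid_expect _ _).
under eq_bigr => a _ do
  rewrite (expected_sqr_average _ (deviation_centered j a)).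
rewrite -mulr_suml exchange_big /= mulrA ler_pdivrMr ?mulr_gt0 ?exprn_gt0 //.
have dist_sum x : \sum_a q x * (hit j x * (X x 0 a - mu j 0 a)) ^+ 2 =
    q x * (hit j x ^+ 2 * sqdist (X x) (mu j)).
  by rewrite /sqdist !mulr_sumr; apply: eq_bigr => a _; rewrite exprMn.
under eq_bigr => x _ do rewrite dist_sum.
have := expected_hit_sqr_le j_heavy (fun x => sqdist_ge0 (X x) (mu j)).
rewrite -(ler_pM2l N_gt0) => /le_trans; apply.
have -> : cluster_cost X f j (mu j) / (m%:R * zeta) * (m%:R * N j ^+ 2) =
    N j * (N j / zeta * cluster_cost X f j (mu j)) by field; rewrite !gt_eqF.
by [].
Qed.

Lemma sum_hit_size_error j xs : 0 < N j -> size xs = m ->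
  \sum_(x <- xs) hit j x = m%:R * N j * (1 + size_error j xs).
Proof.
move=> N_gt0 sz_xs; rewrite /size_error sumrB big_const_seq count_predT sz_xs.
rewrite iter_addr_0 -mulr_natl; field.
by rewrite !gt_eqF // ltr0n.
Qed.

Lemma hit_of_size_error j xs : 0 < N j -> size xs = m ->
  4 * size_error j xs ^+ 2 <= 1 -> m%:R * N j <= 2 * \sum_(x <- xs) hit j x.
Proof.
move=> N_gt0 sz_xs err_le; rewrite sum_hit_size_error //.
have mN_gt0 : 0 < m%:R * N j by rewrite mulr_gt0 // ltr0n.
rewrite mulrCA -[leLHS]mulr1 ler_pM2l //; nra.
Qed.

Lemma has_of_size_error j xs : 0 < N j -> size xs = m ->
  4 * size_error j xs ^+ 2 <= 1 -> has (fun x => f x == j) xs.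
Proof.
move=> N_gt0 sz_xs /(hit_of_size_error N_gt0 sz_xs) hits.
apply: contraLR isT => /hasPn no_hit; suff : m%:R * N j <= 0.
  by rewrite leNgt mulr_gt0 // ltr0n.
apply: le_trans hits _; rewrite big_seq big1 ?mulr0 // => x /no_hit /negbTE fx.
by rewrite /hit fx mul0r.
Qed.

Lemma weighted_mean_error j xs a : 0 < \sum_(x <- xs) hit j x ->
  mu j 0 a - weighted_mean q xs j 0 a =
  - (\sum_(x <- xs) hit j x * (X x 0 a - mu j 0 a)) / \sum_(x <- xs) hit j x.
Proof.
set W := \sum_(x <- xs) hit j x => W_gt0.
have sum_hit (F : I -> R) :
    \sum_(x <- xs | f x == j) (q x)^-1 * F x = \sum_(x <- xs) hit j x * F x.
  rewrite big_mkcond; apply: eq_bigr => x _ /=; rewrite /hit.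
  by case: eqP; rewrite ?mul0r // mul1r.
have sum_hit1 : \sum_(x <- xs | f x == j) (q x)^-1 = W.
  under eq_bigr => x _ do rewrite -[_^-1]mulr1.
  by rewrite sum_hit; apply: eq_bigr => x _; rewrite mulr1.
rewrite [X in _ - X]mxE summxE sum_hit1.
under [in X in _ - X]eq_bigr => x _ do rewrite mxE.
rewrite (sum_hit (fun x => X x 0 a)).
under [in RHS]eq_bigr => x _ do rewrite mulrBr.
by rewrite sumrB -mulr_suml -/W; field; rewrite gt_eqF.
Qed.

Lemma weighted_mean_close j xs : 0 < N j -> size xs = m ->
  4 * size_error j xs ^+ 2 <= 1 ->
  sqdist (mu j) (weighted_mean q xs j) <= 4 * \sum_a mean_error j a xs ^+ 2.
Proof.
move=> N_gt0 sz_xs err_le; have := hit_of_size_error N_gt0 sz_xs err_le.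
set W := \sum_(x <- xs) hit j x => W_ge.
have mN_gt0 : 0 < m%:R * N j by rewrite mulr_gt0 // ltr0n.
have W_gt0 : 0 < W by lra.
rewrite /sqdist mulr_sumr; apply: ler_sum => a _.
rewrite weighted_mean_error // -/W /mean_error; set D := \sum_(x <- xs) _.
rewrite mulNr sqrrN !expr_div_n mulrCA; apply: ler_wpM2l; first exact: sqr_ge0.
have -> : 4 * ((m%:R * N j) ^+ 2)^-1 = ((m%:R * N j / 2) ^+ 2)^-1.
  by field; rewrite !gt_eqF // ltr0n.
rewrite lef_pV2 ?posrE ?exprn_gt0 ?divr_gt0 //.
by rewrite ler_sqr ?nnegrE ?divr_ge0 ?(ltW W_gt0) ?(ltW mN_gt0) //; lra.
Qed.

Definition total_variance : R := \sum_j cluster_cost X f j (mu j).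

Lemma total_variance_ge0 : 0 <= total_variance.
Proof. by apply: sumr_ge0 => j _; apply: cluster_cost_ge0. Qed.

Lemma mean_error_variance0 j a xs : total_variance = 0 -> mean_error j a xs = 0.
Proof.
move=> /(psumr_eq0P (fun j _ => cluster_cost_ge0 X f j _)) cost0.
rewrite /mean_error big1 ?mul0r // => x _; rewrite /hit.
have [fx|_] := eqVneq (f x) j; last by rewrite !mul0r.
suff /eqP -> : X x == mu j by rewrite subrr mulr0.
rewrite -sqdist_eq0; apply/eqP; move: (cost0 j isT).
by move/(psumr_eq0P (fun x _ => sqdist_ge0 (X x) _)); apply; apply/eqP.
Qed.

Definition estimation_failure delta xs : R :=
  \sum_(j | heavy j) (4 * size_error j xs ^+ 2 +
    4 / (delta * total_variance) * (N j * \sum_a mean_error j a xs ^+ 2)).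

Definition centroids_estimated delta xs : Prop :=
  (forall j, heavy j -> has (fun x => f x == j) xs) /\
  \sum_(j | heavy j) N j * sqdist (mu j) (weighted_mean q xs j) <=
    delta * total_variance.

Lemma size_failure_ge0 j xs : 0 <= 4 * size_error j xs ^+ 2.
Proof. by rewrite mulr_ge0 ?sqr_ge0. Qed.

Lemma mean_failure_ge0 delta j xs : 0 < delta ->
  0 <= 4 / (delta * total_variance) * (N j * \sum_a mean_error j a xs ^+ 2).
Proof.
move=> delta_gt0; apply: mulr_ge0.
  by rewrite divr_ge0 // mulr_ge0 ?total_variance_ge0 // ltW.
by rewrite mulr_ge0 ?fiber_size_ge0 // sumr_ge0 // => a _; apply: sqr_ge0.
Qed.

Lemma expected_failure delta : 0 < delta ->
  8 * (#|J|%:R + delta^-1) <= m%:R * zeta ->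
  E (estimation_failure delta) <= 2^-1.
Proof.
move=> delta_gt0 m_ge; set V := total_variance.
have m_pos : 0 < m%:R :> R by rewrite ltr0n.
have mz_gt0 : 0 < m%:R * zeta by rewrite mulr_gt0.
have V_ge0 : 0 <= V := total_variance_ge0.
rewrite /iid_expect chain_expect_sum.
have term_le j : heavy j -> chain_expect (fun=> q) (@push I) m
    (fun xs => 4 * size_error j xs ^+ 2 +
      4 / (delta * V) * (N j * \sum_a mean_error j a xs ^+ 2)) [::] <=
    (4 + 4 / (delta * V) * cluster_cost X f j (mu j)) / (m%:R * zeta).
  move=> j_heavy; rewrite chain_expectD 2!chain_expectZ [leRHS]mulrDl.
  rewrite -[_ * cluster_cost _ _ _ _ / _]mulrA.
  apply: lerD; first by rewrite ler_wpM2l // expected_size_error.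
  rewrite ler_wpM2l ?expected_mean_error // divr_ge0 // mulr_ge0 //; lra.
apply: le_trans (ler_sum _ term_le) _; rewrite -mulr_suml ler_pdivrMr //.
apply: (@le_trans _ _
  (\sum_j (4 + 4 / (delta * V) * cluster_cost X f j (mu j)))).
  rewrite [leRHS](bigID heavy) /= lerDl sumr_ge0 // => j _.
  rewrite addr_ge0 // mulr_ge0 ?cluster_cost_ge0 // divr_ge0 //.
  by rewrite mulr_ge0 // ltW.
rewrite big_split /= sumr_const -mulr_sumr -/total_variance -/V.
rewrite -[4 *+ _]mulr_natr.
suff : 4 / (delta * V) * V <= 4 * delta^-1 by lra.
have [->|V_neq0] := eqVneq V 0; first by rewrite mulr0 mulr_ge0 // invr_ge0 ltW.
by rewrite invfM mulrA divfK.
Qed.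

Lemma estimated_of_failure delta xs : 0 < delta -> size xs = m ->
  estimation_failure delta xs <= 1 -> centroids_estimated delta xs.
Proof.
move=> delta_gt0 sz_xs fail_le; set V := total_variance in fail_le *.
have size_err j : heavy j -> 4 * size_error j xs ^+ 2 <= 1.
  move=> j_heavy; apply: le_trans fail_le.
  rewrite /estimation_failure (bigD1 j) //=.
  rewrite -addrA lerDl addr_ge0 ?mean_failure_ge0 // sumr_ge0 // => l _.
  by rewrite addr_ge0 ?size_failure_ge0 ?mean_failure_ge0.
split=> [j j_heavy|].
  have /andP[N_gt0 _] := j_heavy.
  exact: has_of_size_error (size_err j j_heavy).
apply: (@le_trans _ _
  (4 * \sum_(j | heavy j) N j * \sum_a mean_error j a xs ^+ 2)).
  rewrite mulr_sumr; apply: ler_sum => j j_heavy.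
  have /andP[N_gt0 _] := j_heavy.
  rewrite mulrCA ler_wpM2l ?fiber_size_ge0 //.
  exact: weighted_mean_close (size_err j j_heavy).
have [V0|V_neq0] := eqVneq V 0.
  rewrite -/V V0 mulr0 big1 ?mulr0 // => j _.
  by rewrite big1 ?mulr0 // => a _; rewrite mean_error_variance0 ?expr0n.
have dV_gt0 : 0 < delta * V.
  by rewrite mulr_gt0 // lt_def V_neq0 total_variance_ge0.
rewrite -[leRHS]mul1r -ler_pdivrMr // mulrAC; apply: le_trans fail_le.
rewrite mulr_sumr; apply: ler_sum => j _.
by rewrite lerDr size_failure_ge0.
Qed.

Lemma centroid_estimation delta : 0 < delta ->
  8 * (#|J|%:R + delta^-1) <= m%:R * zeta ->
  2^-1 <= E (fun xs => `[< centroids_estimated delta xs >]%:R).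
Proof.
move=> delta_gt0 m_ge.
apply: (@le_trans _ _ (E (fun xs => 1 + (-1) * estimation_failure delta xs))).
  rewrite /iid_expect chain_expectD chain_expectZ chain_expect_const //.
  have := expected_failure delta_gt0 m_ge; rewrite /iid_expect; lra.
apply: le_chain_expect => [xs a|xs sz_xs]; first exact: ltW.
set ys := foldl _ _ _.
have sz_ys : size ys = m by rewrite size_foldl_push addn0.
have fail_ge0 : 0 <= estimation_failure delta ys.
  apply: sumr_ge0 => j _.
  by rewrite addr_ge0 ?size_failure_ge0 ?mean_failure_ge0.
have [fail_le|fail_gt] := leP (estimation_failure delta ys) 1.
  by rewrite asboolT ?mulN1r ?gerBl //; apply: estimated_of_failure.
by apply: le_trans (ler0n _ _); lra.
Qed.

End CentroidEstimation.

(** * Recovery of near-optimal centers *)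

Section LightClusters.
Variables (R : realType) (d n : nat) (J : finType).
Variables (X : 'I_n -> 'rV[R]_d) (f : 'I_n -> J) (c : J -> 'rV[R]_d).
Variable b : 'I_n -> 'I_n.
Implicit Types (x : 'I_n) (j : J) (C : seq 'rV[R]_d) (u z eps : R).

Local Notation N := (fiber_size R f).
Local Notation cell := (fiber_size R b).
Local Notation D := (anchor_dist X b).
Local Notation A := (anchor_cost X b).
Local Notation OPT := (cost X f c).

(* The point [x] is close to an anchor whose cell is much larger than the
   cluster of [x]. *)
Definition light z x : bool :=
  (D x * N (f x) <= z * A) && (N (f x) <= z * cell (b x)).

Lemma anchor_near (g : 'I_n -> 'rV[R]_d) x :
  exists y, cell (b x) * sqdist (X (b x)) (g y) <=
    2 * (A + \sum_i sqdist (X i) (g i)).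
Proof.
have [y y_le] :=
  exists_le_average (fun i => sqdist (X (b x)) (g i)) (erefl (b x)).
exists y; apply: le_trans y_le _.
rewrite /anchor_cost -big_split mulr_sumr /=.
rewrite [leRHS](bigID (fun i => b i == b x)) /=.
rewrite ler_wpDr ?sumr_ge0 // => [i _|].
  by rewrite mulr_ge0 // addr_ge0 ?anchor_dist_ge0 ?sqdist_ge0.
by apply: ler_sum => i /eqP <-; rewrite [D i]sqdistC sqdist_triangle.
Qed.

Lemma light_near z x (g : 'I_n -> 'rV[R]_d) : 0 <= z -> light z x ->
  exists y, N (f x) * sqdist (X (b x)) (g y) <=
    2 * z * (A + \sum_i sqdist (X i) (g i)).
Proof.
move=> z_ge0 /andP[_ N_le]; have [y y_le] := anchor_near g x; exists y.
apply: le_trans (ler_wpM2r (sqdist_ge0 _ _) N_le) _.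
by rewrite -[leRHS]mulrA mulrCA -mulrA ler_wpM2l.
Qed.

Lemma closest_centers C : C != [::] ->
  exists2 g : 'I_n -> 'rV[R]_d, forall i, g i \in C &
    Phi C X = \sum_i sqdist (X i) (g i).
Proof.
move=> C_neq0; have /choice[g gP] : forall i,
    exists y, y \in C /\ mindist C (X i) = sqdist (X i) y.
  by move=> i; have [y yC ->] := mindist_attained (X i) C_neq0; exists y.
exists g => [i|]; first by have [] := gP i.
by apply: eq_bigr => i _; have [] := gP i.
Qed.

Lemma cluster_served C j y : y \in C ->
  \sum_(i | f i == j) mindist C (X i) <= cluster_cost X f j y.
Proof. by move=> yC; apply: ler_sum => i _; apply: mindist_le. Qed.

Hypothesis voronoi : forall i l, sqdist (X i) (c (f i)) <= sqdist (X i) (c l).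

Lemma light_center_near z C x : 0 <= z -> C != [::] -> light z x ->
  exists2 y, y \in C &
    N (f x) * sqdist (c (f x)) y <= 27 * z * (A + OPT + Phi C X).
Proof.
move=> z_ge0 C_neq0 x_light; have /andP[D_le _] := x_light.
have [g gC PhiE] := closest_centers C_neq0.
have [y1 near_opt] := light_near (fun i => c (f i)) z_ge0 x_light.
have [y2] := light_near g z_ge0 x_light; rewrite -PhiE => near_C.
exists (g y2) => //; rewrite -/(cost _ _ _) in near_opt.
have N_ge0 := fiber_size_ge0 R f (f x).
have own_center : N (f x) * sqdist (X x) (c (f x)) <= 6 * z * A + 4 * z * OPT.
  have := le_trans (voronoi x (f y1)) (sqdist_triangle (X x) (X (b x)) _).
  move/(ler_wpM2l N_ge0); rewrite -/(D x); lra.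
have := ler_wpM2l N_ge0 (sqdist_triangle3 (c (f x)) (X x) (X (b x)) (g y2)).
rewrite (sqdistC (c (f x)) (X x)) -/(D x).
have := mulr_ge0 z_ge0 (cost_ge0 X f c).
have := mulr_ge0 z_ge0 (Phi_ge0 X C_neq0).
lra.
Qed.

Lemma Phi_le_light_heavy u z C (good : pred J) (y : J -> 'rV[R]_d) :
  0 < u -> 0 <= z -> C != [::] ->
  (forall j, good j -> y j \in C) ->
  (forall x, ~~ good (f x) -> exists2 x', f x' = f x & light z x') ->
  Phi C X <= (1 + u) * OPT +
    \sum_(j | good j) N j * sqdist (centroid X f j) (y j) +
    #|J|%:R * ((1 + u^-1) * (27 * z * (A + OPT + Phi C X))).
Proof.
move=> u_gt0 z_ge0 C_neq0 y_in lightP; set F := A + OPT + Phi C X.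
have uV_ge0 : 0 <= u^-1 by rewrite invr_ge0 ltW.
have G_ge0 : 0 <= (1 + u^-1) * (27 * z * F).
  by rewrite mulr_ge0 ?addr_ge0 // mulr_ge0 ?mulr_ge0 // !addr_ge0
    ?anchor_cost_ge0 ?cost_ge0 ?Phi_ge0.
rewrite [leLHS](partition_big f predT) //= cost_clusters mulr_sumr mulr_natl.
rewrite -sumr_const [X in _ + X + _]big_mkcond -!big_split /=.
apply: ler_sum => j _.
have cc_ge0 := cluster_cost_ge0 X f j (c j).
have ucc_ge0 : 0 <= u * cluster_cost X f j (c j) by rewrite mulr_ge0 // ltW.
case: ifP => [good_j|bad_j].
  apply: le_trans (cluster_served j (y_in j good_j)) _.
  rewrite cluster_cost_centroid.
  have := cluster_cost_centroid_le X f j (c j); lra.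
have [x /eqP fx|fiber0] := pickP (fun x => f x == j); last first.
  rewrite big_pred0 //; lra.
have [|x' fx' x'_light] := lightP x; first by rewrite fx bad_j.
have [y' y'C y'_near] := light_center_near z_ge0 C_neq0 x'_light.
rewrite fx' fx -/F in y'_near; apply: le_trans (cluster_served j y'C) _.
apply: le_trans (cluster_cost_young X f j (c j) y' u_gt0) _.
by rewrite addr0 lerD2l ler_wpM2l ?addr_ge0.
Qed.

Lemma Phi_approx eps z C (good : pred J) (y : J -> 'rV[R]_d) :
  0 < eps <= 2^-1 -> 0 <= z -> 12500 * (#|J|%:R * z) <= eps ^+ 2 -> C != [::] ->
  (forall j, good j -> y j \in C) ->
  (forall x, ~~ good (f x) -> exists2 x', f x' = f x & light z x') ->
  A <= 32 * OPT ->
  \sum_(j | good j) N j * sqdist (centroid X f j) (y j) <= eps / 4 * OPT ->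
  Phi C X <= (1 + eps) * OPT.
Proof.
move=> /andP[eps_gt0 eps_le] z_ge0 kz_le C_neq0 y_in lightP A_le sum_le.
have u_gt0 : 0 < eps / 4 by rewrite divr_gt0.
have := Phi_le_light_heavy u_gt0 z_ge0 C_neq0 y_in lightP.
set F := A + OPT + Phi C X; set S := \sum_(j | _) _ in sum_le *.
have OPT_ge0 : 0 <= OPT := cost_ge0 X f c.
have Phi_nneg : 0 <= Phi C X := Phi_ge0 X C_neq0.
have F_ge0 : 0 <= F by rewrite !addr_ge0 ?anchor_cost_ge0.
have light_le : #|J|%:R * ((1 + (eps / 4)^-1) * (27 * z * F)) <= eps / 100 * F.
  have -> : #|J|%:R * ((1 + (eps / 4)^-1) * (27 * z * F)) =
      (27 * (eps + 4) * (#|J|%:R * z) / eps) * F by field; rewrite gt_eqF.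
  by rewrite ler_wpM2r // ler_pdivrMr //; nra.
have F_le : eps / 100 * F <= eps / 100 * (33 * OPT + Phi C X).
  by rewrite ler_wpM2l ?divr_ge0 ?(ltW eps_gt0) // /F; lra.
move=> Phi_le; rewrite -(ler_pM2l (_ : 0 < 1 - eps / 100)); last lra.
apply: (@le_trans _ _ ((1 + 83 / 100 * eps) * OPT)); first lra.
by rewrite mulrA ler_wpM2r //; nra.
Qed.

End LightClusters.

Lemma sample_size_suffices (R : realType) (eps K M : R) :
  0 < eps <= 2^-1 -> 1 <= K ->
  5 * 10 ^+ 6 * K ^+ 3 <= M * eps ^+ 3 ->
  8 * (K + (eps / 4)^-1) <= M * (eps ^+ 2 / (12500 * K) / (10 * K)).
Proof.
move=> /andP[eps_gt0 eps_le] K_ge1 M_ge; have K_gt0 : 0 < K by lra.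
apply: (@le_trans _ _ (40 * K / eps)).
  rewrite ler_pdivlMr // (_ : _ * eps = 8 * K * eps + 32); first nra.
  by field; rewrite gt_eqF.
have -> : M * (eps ^+ 2 / (12500 * K) / (10 * K)) =
    (M * eps ^+ 3) / (125 * 10 ^+ 3 * K ^+ 2) / eps.
  by field; rewrite !gt_eqF.
rewrite ler_pM2r ?invr_gt0 // ler_pdivlMr ?mulr_gt0 ?exprn_gt0 //.
by apply: le_trans M_ge; lra.
Qed.

Section AnchorWeights.
Variables (R : realType) (d n : nat) (J : finType).
Variables (X : 'I_n -> 'rV[R]_d) (f : 'I_n -> J) (c : J -> 'rV[R]_d).
Variables (b : 'I_n -> 'I_n) (i0 : 'I_n).

Local Notation N := (fiber_size R f).
Local Notation cell := (fiber_size R b).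
Local Notation D := (anchor_dist X b).
Local Notation A := (anchor_cost X b).

Definition anchor_weight (x : 'I_n) : R := D x / A + (cell (b x))^-1.

Local Notation W := (\sum_x anchor_weight x).

Lemma anchor_weight_gt0 x : 0 < anchor_weight x.
Proof.
by rewrite ltr_wpDl ?invr_gt0 ?fiber_size_gt0 // divr_ge0 ?anchor_dist_ge0
  ?anchor_cost_ge0.
Qed.

Lemma total_anchor_weight_gt0 : 0 < W.
Proof.
rewrite (bigD1 i0) //= ltr_pwDl ?anchor_weight_gt0 // sumr_ge0 // => x _.
by rewrite ltW ?anchor_weight_gt0.
Qed.

Lemma total_anchor_weight_le (anchors : seq 'I_n) :
  (forall x, b x \in anchors) -> W <= (size anchors).+1%:R.
Proof.
move=> b_in; rewrite big_split /= -natr1 addrC lerD //; last first.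
  rewrite -mulr_suml; have [->|A_neq0] := eqVneq A 0; last by rewrite divff.
  by rewrite invr0 mulr0.
rewrite (partition_big b (mem anchors)) /=; last by move=> x _; apply: b_in.
apply: (@le_trans _ _ (\sum_(p in anchors) 1)); last first.
  by rewrite sumr_const ler_nat card_size.
apply: ler_sum => p _; under eq_bigr => x /eqP -> do [].
rewrite sum_fiber_const; have [->|cell_neq0] := eqVneq (cell p) 0.
  by rewrite mul0r.
by rewrite divff.
Qed.

Lemma light_of_not_heavy (z zeta : R) (x : 'I_n) : zeta * W <= z ->
  ~~ heavy f (fun y => anchor_weight y / W) zeta (f x) ->
  exists2 x', f x' = f x & light X f b z x'.
Proof.
move=> zeta_le; rewrite /heavy fiber_size_gt0 /= negb_forall => /existsP[y].
rewrite negb_imply -ltNge mulrAC ltr_pdivrMr ?total_anchor_weight_gt0 //.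
move=> /andP[/eqP fy lt_zeta]; exists y => //.
have {lt_zeta} /ltW : anchor_weight y * N (f y) < z.
  by rewrite fy (lt_le_trans lt_zeta).
rewrite /anchor_weight mulrDl => weight_le.
have N_ge0 := fiber_size_ge0 R f (f y).
have cost_ge0 : 0 <= D y / A * N (f y).
  by rewrite mulr_ge0 // divr_ge0 ?anchor_dist_ge0 ?anchor_cost_ge0.
have cell_ge0 : 0 <= (cell (b y))^-1 * N (f y) by rewrite mulr_ge0 ?invr_ge0.
apply/andP; split; last first.
  by rewrite -ler_pdivrMr ?fiber_size_gt0 // mulrC; lra.
have [A0|A_neq0] := eqVneq A 0.
  have D0 := psumr_eq0P (fun x _ => anchor_dist_ge0 X b x) A0.
  by rewrite A0 D0 // mul0r mulr0.
have A_gt0 : 0 < A by rewrite lt_def A_neq0 anchor_cost_ge0.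
by rewrite -ler_pdivrMr // mulrAC; lra.
Qed.

Definition recovered (eps : R) (xs : seq 'I_n) : Prop :=
  forall C : seq 'rV[R]_d, C != [::] ->
  (forall j, has (fun x => f x == j) xs ->
     weighted_mean X f anchor_weight xs j \in C) ->
  Phi C X <= (1 + eps) * cost X f c.

Hypothesis voronoi : forall i l, sqdist (X i) (c (f i)) <= sqdist (X i) (c l).

Lemma total_variance_le : total_variance X f <= cost X f c.
Proof.
rewrite cost_clusters; apply: ler_sum => j _.
exact: cluster_cost_centroid_le.
Qed.

Lemma recovered_of_estimated (eps z zeta : R) (xs : seq 'I_n) :
  0 < eps <= 2^-1 -> 0 <= z -> 12500 * (#|J|%:R * z) <= eps ^+ 2 ->
  zeta * W <= z -> A <= 32 * cost X f c ->
  centroids_estimated X f (fun x => anchor_weight x / W) zeta (eps / 4) xs ->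
  recovered eps xs.
Proof.
move=> eps_bnd z_ge0 kz_le zetaW_le A_le [has_heavy sum_le] C C_neq0 C_means.
have W_gt0 := total_anchor_weight_gt0; have /andP[eps_gt0 _] := eps_bnd.
apply: (Phi_approx voronoi (b := b) (z := z) eps_bnd _ _ C_neq0
  (good := heavy f (fun x => anchor_weight x / W) zeta)
  (y := weighted_mean X f anchor_weight xs)) => //.
- by move=> j /has_heavy/C_means.
- by move=> x; apply: light_of_not_heavy.
under eq_bigr => j _ do
  rewrite -(weighted_mean_scale X f _ _ _ (lt0r_neq0 W_gt0)).
apply: le_trans sum_le _; rewrite ler_wpM2l ?total_variance_le //.
by rewrite divr_ge0 // ltW.
Qed.

Lemma recovery (eps : R) (m : nat) (anchors : seq 'I_n) :
  0 < eps <= 2^-1 -> (0 < #|J|)%N ->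
  (forall x, b x \in anchors) -> (size anchors <= (8 * #|J|).+1)%N ->
  A <= 32 * cost X f c -> 5 * 10 ^+ 6 * #|J|%:R ^+ 3 <= m%:R * eps ^+ 3 ->
  2^-1 <= iid_expect (sample_law i0 anchor_weight) m
            (fun xs => `[< recovered eps xs >]%:R) [::].
Proof.
move=> eps_bnd k_gt0 b_in sz_anchors A_le m_ge.
have /andP[eps_gt0 _] := eps_bnd.
set K := #|J|%:R : R in m_ge; have K_ge1 : 1 <= K by rewrite ler1n.
have K_gt0 : 0 < K by lra.
pose z := eps ^+ 2 / (12500 * K); pose zeta := z / (10 * K).
have z_gt0 : 0 < z by rewrite divr_gt0 ?exprn_gt0 // mulr_gt0.
have zeta_gt0 : 0 < zeta by rewrite divr_gt0 // mulr_gt0.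
have W_le : W <= 10 * K.
  apply: le_trans (total_anchor_weight_le b_in) _.
  apply: (@le_trans _ _ (8 * #|J|).+2%:R); first by rewrite ler_nat.
  by rewrite -!natr1 natrM -/K; lra.
have zetaW_le : zeta * W <= z.
  by rewrite /zeta mulrAC ler_pdivrMr ?mulr_gt0 ?ler_pM2l.
have kz_le : 12500 * (K * z) <= eps ^+ 2.
  by rewrite /z mulrA [_ * (_ / _)]mulrC divfK // gt_eqF // mulr_gt0.
pose q x := anchor_weight x / W.
have lawE : sample_law i0 anchor_weight = q.
  by apply/funext => x; rewrite /sample_law gt_eqF ?total_anchor_weight_gt0.
have q_gt0 x : 0 < q x.
  by rewrite divr_gt0 ?anchor_weight_gt0 ?total_anchor_weight_gt0.
have q_sum : \sum_x q x = 1 by rewrite -lawE sample_law_sum.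
have m_gt0 : (0 < m)%N.
  case: (m) m_ge => //; rewrite mul0r leNgt.
  by rewrite !mulr_gt0 ?exprn_gt0.
have := centroid_estimation X f q_gt0 q_sum zeta_gt0 m_gt0
  (divr_gt0 eps_gt0 (ltr0Sn R 3)) (sample_size_suffices eps_bnd K_ge1 m_ge).
rewrite lawE => /le_trans; apply.
apply: le_chain_expect => [_ x|xs _]; first exact: ltW.
rewrite ler_nat; case: asboolP => // estimated; rewrite asboolT //.
exact: recovered_of_estimated eps_bnd (ltW z_gt0) kz_le zetaW_le A_le estimated.
Qed.

End AnchorWeights.

Lemma Phi_optimal (R : realType) (d n k : nat) (X : 'I_n -> 'rV[R]_d)
    (f : 'I_n -> 'I_k) (c : 'I_k -> 'rV[R]_d) :
  (forall i l, sqdist (X i) (c (f i)) <= sqdist (X i) (c l)) ->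
  Phi [seq c l | l : 'I_k] X = cost X f c.
Proof.
move=> voronoi; apply: eq_bigr => i _; apply: le_anti.
have mem_c l : c l \in [seq c l | l : 'I_k] by rewrite map_f ?mem_enum.
rewrite mindist_le ?mem_c //=.
have [|y /mapP[l _ ->] ->] := @mindist_attained R d [seq c l | l : 'I_k] (X i).
  by apply/eqP => C0; have := mem_c (f i); rewrite C0.
exact: voronoi.
Qed.

(** * A program logic *)

Fixpoint iwrites (c : cmd) : seq nat :=
  match c with
  | Skip | RStore _ _ _ => [::]
  | Seq c1 c2 | If _ c1 c2 => iwrites c1 ++ iwrites c2
  | While _ c1 => iwrites c1
  | IStore a _ _ | Flip a _ _ | Query a _ _ _ => [:: a]
  end.

Fixpoint rwrites (c : cmd) : seq nat :=
  match c with
  | Skip | IStore _ _ _ | Flip _ _ _ | Query _ _ _ _ => [::]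
  | Seq c1 c2 | If _ c1 c2 => rwrites c1 ++ rwrites c2
  | While _ c1 => rwrites c1
  | RStore a _ _ => [:: a]
  end.

Fixpoint query_free (c : cmd) : bool :=
  match c with
  | Seq c1 c2 | If _ c1 c2 => query_free c1 && query_free c2
  | While _ c1 => query_free c1
  | Query _ _ _ _ => false
  | _ => true
  end.

Lemma update_same (T : Type) (mem : nat -> nat -> T) a i v j :
  update mem a i v a j = if j == i then v else mem a j.
Proof. by rewrite /update eqxx. Qed.

Lemma update_other (T : Type) (mem : nat -> nat -> T) a i v b j :
  b != a -> update mem a i v b j = mem b j.
Proof. by rewrite /update => /negbTE ->. Qed.

Section Frame.
Variable R : realType.
Implicit Types (s : state R) (c : cmd).

Definition frame c s s' : Prop :=
  [/\ forall a i, a \notin iwrites c -> imem s' a i = imem s a i,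
      forall a i, a \notin rwrites c -> rmem s' a i = rmem s a i
    & query_free c -> nqueries s' = nqueries s].

Lemma frame_imem c s s' a i :
  frame c s s' -> a \notin iwrites c -> imem s' a i = imem s a i.
Proof. by case=> i_eq _ _; apply: i_eq. Qed.

Lemma frame_rmem c s s' a i :
  frame c s s' -> a \notin rwrites c -> rmem s' a i = rmem s a i.
Proof. by case=> _ r_eq _; apply: r_eq. Qed.

Lemma frame_queries c s s' :
  frame c s s' -> query_free c -> nqueries s' = nqueries s.
Proof. by case. Qed.

Lemma frame_refl c s : frame c s s.
Proof. by []. Qed.

Lemma frame_trans c s1 s2 s3 : frame c s1 s2 -> frame c s2 s3 -> frame c s1 s3.
Proof.
move=> [i12 r12 q12] [i23 r23 q23]; split=> [a i a_notin|a i a_notin|c_free].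
- by rewrite i23 ?i12.
- by rewrite r23 ?r12.
- by rewrite q23 ?q12.
Qed.

Lemma frame_sub c c' s s' :
  {subset iwrites c <= iwrites c'} -> {subset rwrites c <= rwrites c'} ->
  (query_free c' -> query_free c) -> frame c s s' -> frame c' s s'.
Proof.
move=> sub_i sub_r sub_q [i_eq r_eq q_eq]; split=> [a i|a i|/sub_q/q_eq //].
- by move=> /(contra (sub_i a))/i_eq.
- by move=> /(contra (sub_r a))/r_eq.
Qed.

Definition writes_within c c' : bool :=
  [&& all (mem (iwrites c')) (iwrites c), all (mem (rwrites c')) (rwrites c)
    & query_free c' ==> query_free c].

Lemma frame_extend c c' s1 s2 s3 :
  frame c' s1 s2 -> frame c s2 s3 -> writes_within c c' -> frame c' s1 s3.
Proof.
move=> fr12 fr23 /and3P[/allP sub_i /allP sub_r /implyP sub_q].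
exact: frame_trans fr12 (frame_sub sub_i sub_r sub_q fr23).
Qed.

Lemma frame_seql c1 c2 s s' : frame c1 s s' -> frame (Seq c1 c2) s s'.
Proof.
apply: frame_sub => [a a_in|a a_in|/andP[] //] /=.
- by rewrite mem_cat a_in.
- by rewrite mem_cat a_in.
Qed.

Lemma frame_seqr c1 c2 s s' : frame c2 s s' -> frame (Seq c1 c2) s s'.
Proof.
apply: frame_sub => [a a_in|a a_in|/andP[] //] /=.
- by rewrite mem_cat a_in orbT.
- by rewrite mem_cat a_in orbT.
Qed.

Lemma frame_seq c1 c2 s1 s2 s3 :
  frame c1 s1 s2 -> frame c2 s2 s3 -> frame (Seq c1 c2) s1 s3.
Proof.
by move=> /(@frame_seql _ c2) fr12 /(@frame_seqr c1); apply: frame_trans.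
Qed.

Lemma frame_if b c1 c2 s s' :
  frame (if beval s b then c1 else c2) s s' -> frame (If b c1 c2) s s'.
Proof. by case: ifP => _; [apply: frame_seql | apply: frame_seqr]. Qed.

Lemma frame_set_int c a i v s s' :
  a \in iwrites c -> frame c s s' -> frame c s (set_int s' a i v).
Proof.
move=> a_in [i_eq r_eq q_eq]; split=> //= a' j a'_notin.
by rewrite /update; case: eqP a_in a'_notin => [->|_ _ /i_eq //] ->.
Qed.

Lemma frame_set_real c a i v s s' :
  a \in rwrites c -> frame c s s' -> frame c s (set_real s' a i v).
Proof.
move=> a_in [i_eq r_eq q_eq]; split=> //= a' j a'_notin.
by rewrite /update; case: eqP a_in a'_notin => [->|_ _ /r_eq //] ->.
Qed.

End Frame.

Definition ivar (a : nat) : iexp := ILoad a (ICst 0).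
Definition rvar (a : nat) : rexp := RLoad a (ICst 0).
Definition iset (a : nat) (e : iexp) : cmd := IStore a (ICst 0) e.
Definition rset (a : nat) (e : rexp) : cmd := RStore a (ICst 0) e.
Definition incr (a : nat) : cmd := iset a (IAdd (ivar a) (ICst 1)).

Definition for_cmd (a : nat) (e : iexp) (c : cmd) : cmd :=
  Seq (iset a (ICst 0)) (While (BNot (BLeI e (ivar a))) (Seq c (incr a))).

Section WeakestPreconditions.
Variables (R : realType) (orc : nat -> nat -> bool) (Q E : state R -> Prop).
Implicit Types (s : state R) (v : R) (c : cmd) (K : seq cmd).
Implicit Types (Post : state R -> R -> Prop).

Definition achieves (T : nat) (cfg : config R) (v : R) : Prop :=
  always orc T cfg Q /\ v <= Pr orc T cfg E.

Lemma always_Pr_mono T T' cfg : (T <= T')%N -> always orc T cfg Q ->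
  always orc T' cfg Q /\ Pr orc T' cfg E = Pr orc T cfg E.
Proof.
elim: T T' cfg => [|T IH] [|T'] cfg //=; rewrite ?ltnS;
  case: (Defs.next orc cfg) => //.
- by move=> cfg' le_T /(IH _ _ le_T).
- by move=> p c1 c2 le_T [/(IH _ _ le_T)[? ->] /(IH _ _ le_T)[? ->]].
Qed.

Lemma achieves_leq T T' cfg v :
  (T <= T')%N -> achieves T cfg v -> achieves T' cfg v.
Proof.
move=> le_T [/(always_Pr_mono le_T)[always_T' PrE] Pr_ge].
by split; rewrite ?PrE.
Qed.

Lemma achieves_le T cfg v v' : v' <= v -> achieves T cfg v -> achieves T cfg v'.
Proof. by move=> le_v [always_T Pr_ge]; split=> //; apply: le_trans Pr_ge. Qed.

Lemma achieves_step T cfg cfg' v : Defs.next orc cfg = Step cfg' ->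
  achieves T cfg' v -> achieves T.+1 cfg v.
Proof. by move=> next_cfg; rewrite /achieves /= next_cfg. Qed.

(* [Post] relates a final state to the success probability that the rest of the
   program has to guarantee from there. *)
Record wp (t : nat) c s v Post : Prop := Wp {
  run_wp : forall K T,
    (forall s' v', frame c s s' -> Post s' v' -> achieves T (K, s') v') ->
    achieves (t + T) (c :: K, s) v }.

Lemma wp_mono t c s v (Post Post' : state R -> R -> Prop) : wp t c s v Post ->
  (forall s' v', frame c s s' -> Post s' v' -> Post' s' v') -> wp t c s v Post'.
Proof.
move=> wp_c sub; split=> K T ok.
by apply: (run_wp wp_c) => s' v' fr /(sub _ _ fr); apply: ok.
Qed.

Lemma wp_leq t t' c s v Post :
  wp t c s v Post -> (t <= t')%N -> wp t' c s v Post.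
Proof.
move=> wp_c le_t; split=> K T ok.
by apply: achieves_leq (run_wp wp_c ok); rewrite leq_add2r.
Qed.

Lemma wp_skip t s v Post : (0 < t)%N -> Post s v -> wp t Skip s v Post.
Proof.
move=> t_gt0 post; apply: wp_leq t_gt0; split=> K T ok; rewrite add1n.
by apply: achieves_step => //=; apply: ok.
Qed.

Lemma wp_istore a i e s v Post :
  Post (set_int s a (ieval s i) (ieval s e)) v -> wp 1 (IStore a i e) s v Post.
Proof.
move=> post; split=> K T ok; rewrite add1n; apply: achieves_step => //=.
apply: ok post.
by apply: frame_set_int (frame_refl _ _); rewrite mem_head.
Qed.

Lemma wp_rstore a i e s v Post :
  Post (set_real s a (ieval s i) (reval s e)) v -> wp 1 (RStore a i e) s v Post.
Proof.
move=> post; split=> K T ok; rewrite add1n; apply: achieves_step => //=.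
apply: ok post.
by apply: frame_set_real (frame_refl _ _); rewrite mem_head.
Qed.

Lemma wp_query a i e1 e2 s v Post :
  Post (set_int (add_query s) a (ieval s i)
          (orc (ieval s e1) (ieval s e2))) v ->
  wp 1 (Query a i e1 e2) s v Post.
Proof.
move=> post; split=> K T ok; rewrite add1n; apply: achieves_step => //=.
apply: ok post.
by apply: frame_set_int; rewrite ?mem_head.
Qed.

Lemma wp_flip a i e s v v1 v2 Post :
  Post (set_int s a (ieval s i) 1) v1 -> Post (set_int s a (ieval s i) 0) v2 ->
  v <= clamp01 (reval s e) * v1 + (1 - clamp01 (reval s e)) * v2 ->
  wp 1 (Flip a i e) s v Post.
Proof.
move=> post1 post2 v_le; split=> K T ok; rewrite add1n.
have fr (x : nat) : frame (Flip a i e) s (set_int s a (ieval s i) x).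
  by apply: frame_set_int (frame_refl _ _); rewrite mem_head.
have [always1 Pr1] := ok _ _ (fr 1%N) post1.
have [always2 Pr2] := ok _ _ (fr 0%N) post2.
split=> //=; apply: le_trans v_le _; set p := clamp01 _.
have p_ge0 : 0 <= p by rewrite /p /clamp01 le_min le_max lexx ler01.
have p_le1 : p <= 1 by rewrite /p /clamp01 ge_min lexx.
by rewrite lerD // ler_wpM2l // subr_ge0.
Qed.

Lemma wp_seq t1 t2 c1 c2 s v Post :
  wp t1 c1 s v (fun s' v' => wp t2 c2 s' v' Post) ->
  wp (t1 + t2).+1 (Seq c1 c2) s v Post.
Proof.
move=> wp1; split=> K T ok; rewrite addSn -addnA; apply: achieves_step => //=.
apply: (run_wp wp1) => s1 v1 fr1 wp2; apply: (run_wp wp2) => s2 v2 fr2.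
by apply: ok; apply: frame_seq fr1 fr2.
Qed.

Lemma wp_if t b c1 c2 s v Post :
  wp t (if beval s b then c1 else c2) s v Post -> wp t.+1 (If b c1 c2) s v Post.
Proof.
move=> wp_c; split=> K T ok; rewrite addSn; apply: achieves_step => //=.
by apply: (run_wp wp_c) => s' v' /frame_if; apply: ok.
Qed.

Lemma wp_while t b c (inv : nat -> state R -> R -> Prop) Post m s v :
  (forall i s' v', frame (While b c) s s' -> inv i s' v' -> if beval s' b
     then (0 < i)%N /\ wp t c s' v' (inv i.-1) else Post s' v') ->
  inv m s v -> wp (m * t.+1).+1 (While b c) s v Post.
Proof.
move=> inv_step inv_s; split=> K T ok.
suff loop s1 v1 : inv m s1 v1 -> frame (While b c) s s1 ->
    achieves ((m * t.+1).+1 + T) (While b c :: K, s1) v1.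
  exact: loop inv_s (frame_refl _ _).
elim/ltn_ind: m {inv_s} s1 v1 => m IH s1 v1 inv_s1 fr1.
have := inv_step _ _ _ fr1 inv_s1; case: ifP => b_eval; last first.
  move=> post; rewrite addSn; apply: (@achieves_step _ _ (K, s1)).
    by rewrite /= b_eval.
  exact: achieves_leq (leq_addl _ _) (ok _ _ fr1 post).
case=> m_gt0 wp_c; rewrite addSn.
apply: (@achieves_step _ _ (c :: While b c :: K, s1)).
  by rewrite /= b_eval.
rewrite -[X in (X * _)%N](prednK m_gt0) mulSn -addnA addSnnS.
apply: (run_wp wp_c) => s2 v2 fr2 inv_s2.
rewrite -addSn; apply: IH inv_s2 _; first by rewrite prednK.
exact: frame_trans fr1 fr2.
Qed.

Lemma wp_for t T a e c (inv : nat -> state R -> R -> Prop) Post m s v :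
  a \notin iwrites c ->
  (forall s', frame (for_cmd a e c) s s' -> ieval s' e = m) ->
  inv 0 (set_int s a 0 0) v ->
  (forall i s' v', (i < m)%N -> frame (for_cmd a e c) s s' -> imem s' a 0 = i ->
     inv i s' v' ->
     wp t c s' v' (fun s2 v2 => inv i.+1 (set_int s2 a 0 i.+1) v2)) ->
  (forall s' v', inv m s' v' -> Post s' v') -> (m * (t + 3) + 3 <= T)%N ->
  wp T (for_cmd a e c) s v Post.
Proof.
move=> a_notin e_eval inv0 body post le_T.
pose J i s' v' :=
  [/\ (i <= m)%N, imem s' a 0 = (m - i)%N & inv (m - i)%N s' v'].
apply: wp_leq.
  apply: wp_seq; apply: wp_istore.
  apply: (wp_while (t := (t + 1).+1) (inv := J) (m := m)).
    move=> i s1 v1 fr [le_im a_eval inv_s1] /=.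
    have fr1 : frame (for_cmd a e c) s s1.
      apply: frame_trans (frame_seqr _ fr).
      by apply: frame_set_int (frame_refl _ _); rewrite mem_head.
    rewrite e_eval // -ltnNge a_eval; case: ltnP => lt_m; last first.
      by apply: post; rewrite (_ : (m - i)%N = m) // in inv_s1; lia.
    split; first lia.
    apply: wp_seq; apply: wp_mono (body _ _ _ lt_m fr1 a_eval inv_s1) _.
    move=> s2 v2 fr2 inv_s2; apply: wp_istore.
    rewrite /= (frame_imem _ fr2) // a_eval addn1 /J.
    rewrite (_ : (m - i.-1) = (m - i).+1)%N; last lia.
    by split=> //; [lia | rewrite /= update_same eqxx].
  by split; rewrite ?subnn // /= update_same eqxx.
lia.
Qed.

Lemma wp_frame t c s v Post :
  wp t c s v (fun s' v' => frame c s s' -> Post s' v') -> wp t c s v Post.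
Proof. by move/wp_mono; apply=> s' v' fr; apply. Qed.

(* A command that tosses no coins preserves the guaranteed probability. *)
Record exec (t : nat) c s (P : state R -> Prop) : Prop := Exec {
  exec_const : forall v, wp t c s v (fun s' v' => v' = v /\ P s') }.

Lemma wp_exec t c s v P Post : exec t c s P ->
  (forall s', frame c s s' -> P s' -> Post s' v) -> wp t c s v Post.
Proof.
move=> exec_c sub; apply: wp_mono (exec_const exec_c v) _.
by move=> s' _ fr [-> /(sub _ fr)].
Qed.

Lemma exec_mono t c s (P P' : state R -> Prop) : exec t c s P ->
  (forall s', frame c s s' -> P s' -> P' s') -> exec t c s P'.
Proof.
move=> exec_c sub; split=> v; apply: wp_exec exec_c _.
by move=> s' fr /(sub _ fr).
Qed.

Lemma exec_for t T a e c (inv : nat -> state R -> Prop) (P : state R -> Prop)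
    m s :
  a \notin iwrites c ->
  (forall s', frame (for_cmd a e c) s s' -> ieval s' e = m) ->
  inv 0 (set_int s a 0 0) ->
  (forall i s', (i < m)%N -> frame (for_cmd a e c) s s' -> imem s' a 0 = i ->
     inv i s' -> exec t c s' (fun s2 => inv i.+1 (set_int s2 a 0 i.+1))) ->
  (forall s', frame (for_cmd a e c) s s' -> inv m s' -> P s') ->
  (m * (t + 3) + 3 <= T)%N -> exec T (for_cmd a e c) s P.
Proof.
move=> a_notin e_eval inv0 body post le_T; split=> v; apply: wp_frame.
apply: (wp_for (inv := fun i s' v' => v' = v /\ inv i s')) e_eval _ _ _ le_T
  => //.
- by move=> i s1 v1 lt_im fr a_eval [-> inv_s1]; apply: exec_const; apply: body.
- by move=> s1 v1 [-> inv_s1] fr; split=> //; apply: post.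
Qed.

Lemma wp_for_chain (S : Type) (I : finType) (law : S -> I -> R)
    (move_to : S -> I -> S) (h : S -> R) (repr : S -> state R -> Prop)
    t T a e c m x s Post :
  a \notin iwrites c ->
  (forall s', frame (for_cmd a e c) s s' -> ieval s' e = m) ->
  repr x (set_int s a 0 0) ->
  (forall i s' y (g : S -> R), (i < m)%N -> frame (for_cmd a e c) s s' ->
     repr y s' ->
     wp t c s' (\sum_u law y u * g (move_to y u)) (fun s2 v2 =>
       exists2 u, v2 = g (move_to y u) &
         repr (move_to y u) (set_int s2 a 0 i.+1))) ->
  (forall s' us (y := foldl move_to x us), size us = m ->
     repr y s' -> Post s' (h y)) ->
  (m * (t + 3) + 3 <= T)%N ->
  wp T (for_cmd a e c) s (chain_expect law move_to m h x) Post.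
Proof.
move=> a_notin e_eval repr0 body post le_T.
pose inv i s' v' := exists us (y := foldl move_to x us), [/\ size us = i,
  v' = chain_expect law move_to (m - i) h y & repr y s'].
apply: (wp_for (inv := inv)) e_eval _ _ _ le_T => //.
- by exists [::]; split; rewrite ?subn0.
- move=> i s1 _ lt_im fr _ [us [sz_us -> repr_us]]; rewrite -(subnSK lt_im) /=.
  have := body i s1 _ (chain_expect law move_to (m - i.+1) h) lt_im fr repr_us.
  move/wp_mono; apply=> s2 _ _ [u -> repr_u]; exists (rcons us u).
  by rewrite size_rcons foldl_rcons sz_us.
- move=> s1 _ [us [sz_us -> repr_us]]; rewrite subnn.
  exact: post sz_us repr_us.
Qed.


End WeakestPreconditions.

(** * The program *)

Definition dims : nat := 0.
Definition drawn_var : nat := 1.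
Definition point_var : nat := 2.
Definition coord_var : nat := 3.
Definition anchor_arr : nat := 4.
Definition coin_var : nat := 5.
Definition round_var : nat := 6.
Definition cell_arr : nat := 7.
Definition ndraws_var : nat := 8.
Definition slot_var : nat := 9.
Definition nslots_var : nat := 10.
Definition rep_arr : nat := 11.
Definition answer_var : nat := 12.
Definition probe_var : nat := 13.
Definition repeat_var : nat := 14.

Definition points_arr : nat := 0.
Definition centers_arr : nat := 1.
Definition eps_var : nat := 2.
Definition dist_arr : nat := 3.
Definition sq_var : nat := 4.
Definition total_var : nat := 5.
Definition cost_var : nat := 6.
Definition weight_arr : nat := 7.
Definition mass_arr : nat := 8.
Definition moment_arr : nat := 9.
Definition mean_arr : nat := 10.
Definition bound_var : nat := 11.

Definition nE : iexp := ILoad dims (ICst 0).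
Definition dE : iexp := ILoad dims (ICst 1).
Definition kE : iexp := ILoad dims (ICst 2).

Definition zeroR : rexp := ROfI (ICst 0).
Definition oneR : rexp := ROfI (ICst 1).

Definition eq_exp (e1 e2 : iexp) : bexp := BAnd (BLeI e1 e2) (BLeI e2 e1).
Definition or_exp (b1 b2 : bexp) : bexp := BNot (BAnd (BNot b1) (BNot b2)).
Definition is_set (x : nat) : bexp := BLeI (ICst 1) (ivar x).

Definition entry_index (x : nat) (j : iexp) : iexp := IAdd (IMul (ivar x) dE) j.
Definition entry (A x : nat) (j : iexp) : rexp := RLoad A (entry_index x j).

Definition row_cmd (A x : nat) (e : rexp) : cmd :=
  for_cmd coord_var dE (RStore A (entry_index x (ivar coord_var)) e).

Definition dist_cmd (A x y : nat) : cmd :=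
  let diff := RSub (entry A x (ivar coord_var)) (entry A y (ivar coord_var)) in
  Seq (rset sq_var zeroR)
    (for_cmd coord_var dE (rset sq_var (RAdd (rvar sq_var) (RMul diff diff)))).

Definition reassign_cmd (closer : bexp) : cmd :=
  If closer
    (Seq (RStore dist_arr (ivar point_var) (rvar sq_var))
         (IStore anchor_arr (ivar point_var) (ivar drawn_var)))
    Skip.

Definition update_cmd (closer : bexp) : cmd :=
  for_cmd point_var nE
    (Seq (dist_cmd points_arr point_var drawn_var) (reassign_cmd closer)).

(* Reservoir sampling: the point seen last replaces the current one with the
   probability that its weight represents among the weights seen so far. *)
Definition sample_cmd (A : nat) : cmd :=
  Seq (rset total_var zeroR)
 (Seq (iset drawn_var (ICst 0))
 (for_cmd point_var nE
   (Seq (rset total_var (RAdd (rvar total_var) (RLoad A (ivar point_var))))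
   (Seq (Flip coin_var (ICst 0)
           (RDiv (RLoad A (ivar point_var)) (rvar total_var)))
        (If (is_set coin_var) (iset drawn_var (ivar point_var)) Skip))))).

Definition closer_to_drawn : bexp :=
  BLeR (rvar sq_var) (RLoad dist_arr (ivar point_var)).

Definition seed_cmd : cmd :=
  Seq (update_cmd (BLeI (ICst 0) (ICst 0)))
      (for_cmd round_var (IMul (ICst 8) kE)
        (Seq (sample_cmd dist_arr) (update_cmd closer_to_drawn))).

Definition cells_cmd : cmd :=
  let anchor := ILoad anchor_arr (ivar point_var) in
  for_cmd point_var nE
    (Seq (rset cost_var
            (RAdd (rvar cost_var) (RLoad dist_arr (ivar point_var))))
         (IStore cell_arr anchor (IAdd (ILoad cell_arr anchor) (ICst 1)))).

Definition weigh_cmd : cmd :=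
  let anchor := ILoad anchor_arr (ivar point_var) in
  for_cmd point_var nE
    (RStore weight_arr (ivar point_var)
       (RAdd (RDiv (RLoad dist_arr (ivar point_var)) (rvar cost_var))
             (RDiv oneR (ROfI (ILoad cell_arr anchor))))).

(* The oracle answers negatively on equal points. *)
Definition same_slot : bexp :=
  or_exp (is_set answer_var)
         (eq_exp (ILoad rep_arr (ivar probe_var)) (ivar drawn_var)).

Definition locate_cmd : cmd :=
  Seq (iset slot_var (ivar nslots_var))
      (for_cmd probe_var (ivar nslots_var)
        (Seq (Query answer_var (ICst 0)
                (ILoad rep_arr (ivar probe_var)) (ivar drawn_var))
             (If same_slot (iset slot_var (ivar probe_var)) Skip))).

(* By truncated subtraction, the number of slots becomes the maximum of itself
   and [slot + 1]. *)
Definition open_cmd : cmd :=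
  Seq (IStore rep_arr (ivar slot_var) (ivar drawn_var))
      (iset nslots_var (IAdd (ivar nslots_var)
         (ISub (IAdd (ivar slot_var) (ICst 1)) (ivar nslots_var)))).

Definition add_point_cmd : cmd :=
  let weight := RLoad weight_arr (ivar drawn_var) in
  Seq (RStore mass_arr (ivar slot_var)
         (RAdd (RLoad mass_arr (ivar slot_var)) (RDiv oneR weight)))
      (row_cmd moment_arr slot_var
         (RAdd (entry moment_arr slot_var (ivar coord_var))
               (RDiv (entry points_arr drawn_var (ivar coord_var)) weight))).

Definition place_cmd : cmd := Seq locate_cmd (Seq open_cmd add_point_cmd).

Definition more_draws (M : nat) : bexp :=
  BLeR (RMul (ROfI (IAdd (ivar ndraws_var) (ICst 1)))
             (RMul (rvar eps_var) (RMul (rvar eps_var) (rvar eps_var))))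
       (ROfI (IMul (ICst M) (IMul kE (IMul kE kE)))).

Definition count_cmd (M : nat) : cmd :=
  While (more_draws M) (incr ndraws_var).

Definition recover_cmd : cmd :=
  for_cmd round_var (ivar ndraws_var) (Seq (sample_cmd weight_arr) place_cmd).

Definition means_cmd : cmd :=
  let first := entry mean_arr slot_var (ICst 0) in
  Seq (rset bound_var oneR)
      (for_cmd slot_var kE
        (Seq (row_cmd mean_arr slot_var
                (RDiv (entry moment_arr slot_var (ivar coord_var))
                      (RLoad mass_arr (ivar slot_var))))
             (rset bound_var (RAdd (rvar bound_var) (RMul first first))))).

Definition find_repeat_cmd : cmd :=
  Seq (iset repeat_var (ICst 0))
      (for_cmd probe_var (ivar slot_var)
        (Seq (dist_cmd mean_arr slot_var probe_var)
             (If (BLeR (rvar sq_var) zeroR) (iset repeat_var (ICst 1)) Skip))).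

Definition copy_mean_cmd : cmd :=
  row_cmd centers_arr slot_var (entry mean_arr slot_var (ivar coord_var)).

(* A mean that repeats an earlier one is moved away: its first coordinate
   becomes larger than those of all means. *)
Definition move_repeat_cmd : cmd :=
  If (is_set repeat_var)
    (RStore centers_arr (entry_index slot_var (ICst 0))
       (RAdd (rvar bound_var) (ROfI (ivar slot_var))))
    Skip.

Definition dedup_cmd : cmd :=
  for_cmd slot_var kE (Seq find_repeat_cmd (Seq copy_mean_cmd move_repeat_cmd)).

Definition prog (M : nat) : cmd :=
  Seq seed_cmd (Seq cells_cmd (Seq weigh_cmd
    (Seq (count_cmd M) (Seq recover_cmd (Seq means_cmd dedup_cmd))))).

Definition seed_time (n d k : nat) : nat :=
  8 * k * (n * (d * 4 + 22) + 14) + n * (d * 4 + 13) + 7.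

Definition output_time (d k : nat) : nat :=
  (k * (d * 4 + 8) + 5 + (k * (k * (d * 4 + 11) + d * 4 + 15) + 3)).+1.

Definition recovery_time (n d k m : nat) : nat :=
  (m * 2 + 1 +
   (m * (n * 9 + k * 7 + d * 4 + 26) + 3 + output_time d k).+1).+1.

Definition prog_time (n d k m : nat) : nat :=
  (seed_time n d k +
    (n * 6 + 3 + (n * 4 + 3 + recovery_time n d k m).+1).+1).+1.

(** * Correctness of the subroutines *)

Lemma row_index_eq (d l l' j j' : nat) : (j < d)%N -> (j' < d)%N ->
  (l * d + j == l' * d + j')%N = (l == l') && (j == j').
Proof.
move=> lt_j lt_j'; apply/eqP/andP => [eq_index|[/eqP-> /eqP->] //].
have d_gt0 : (0 < d)%N by apply: leq_ltn_trans lt_j.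
have := congr1 (divn^~ d) eq_index.
rewrite /= !divnMDl // !divn_small // !addn0 => ->.
by have := congr1 (modn^~ d) eq_index; rewrite /= !modnMDl !modn_small // => ->.
Qed.

Section Rows.
Variables (R : realType) (d : nat).
Implicit Types (s : state R) (c : cmd) (A l x y : nat).

Definition mem_row A s l : 'rV[R]_d := \row_(j < d) rmem s A (l * d + j).

Lemma mem_row_frame A c s s' l :
  frame c s s' -> A \notin rwrites c -> mem_row A s' l = mem_row A s l.
Proof.
by move=> fr A_notin; apply/rowP => j; rewrite !mxE (frame_rmem _ fr).
Qed.

Variables (orc : nat -> nat -> bool) (Q E : state R -> Prop).
Local Notation exec := (exec orc Q E).

Lemma dist_spec A x y s :
  A != sq_var -> x != coord_var -> y != coord_var -> imem s dims 1 = d ->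
  exec (d * 4 + 5) (dist_cmd A x y) s (fun s' => rmem s' sq_var 0 =
    sqdist (mem_row A s (imem s x 0)) (mem_row A s (imem s y 0))).
Proof.
move=> A_neq x_neq y_neq d_eval; split=> v.
pose F j :=
  (rmem s A (imem s x 0 * d + j) - rmem s A (imem s y 0 * d + j)) ^+ 2.
have -> : sqdist (mem_row A s (imem s x 0)) (mem_row A s (imem s y 0)) =
    \sum_(j < d) F j.
  by apply: eq_bigr => j _; rewrite !mxE.
apply: wp_leq.
  apply: wp_seq; apply: wp_rstore.
  apply: exec_const; apply: (exec_for (T := d * 4 + 3) (m := d) (t := 1)
    (inv := fun i s' => rmem s' sq_var 0 = \sum_(j < i) F j)) => //.
  - by move=> s' fr; rewrite /= (frame_imem _ fr).
  - by rewrite big_ord0.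
  - move=> i s1 _ fr i_eval sum_eval; split=> v'.
    apply: wp_rstore; split=> //.
    have mem_x : imem s1 x 0 = imem s x 0.
      by rewrite (frame_imem _ fr) // !inE negb_or x_neq.
    have mem_y : imem s1 y 0 = imem s y 0.
      by rewrite (frame_imem _ fr) // !inE negb_or y_neq.
    have mem_A p : rmem s1 A p = rmem s A p.
      by rewrite (frame_rmem _ fr) /= ?inE // update_other.
    rewrite big_ord_recr -sum_eval /= update_same eqxx /F expr2.
    have d_eval1 : imem s1 dims 1 = d by rewrite (frame_imem _ fr).
    by rewrite i_eval mem_x mem_y !mem_A d_eval1.
by lia.
Qed.

Lemma row_spec A x e s (r : 'rV[R]_d) :
  x != coord_var -> imem s dims 1 = d ->
  (forall s' (j : 'I_d), frame (row_cmd A x e) s s' ->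
     imem s' coord_var 0 = j ->
     rmem s' A (imem s x 0 * d + j) = rmem s A (imem s x 0 * d + j) ->
     reval s' e = r 0 j) ->
  exec (d * 4 + 3) (row_cmd A x e) s (fun s' => forall l,
    mem_row A s' l = if l == imem s x 0 then r else mem_row A s l).
Proof.
move=> x_neq d_eval e_eval; set l0 := imem s x 0.
pose inv i s' := forall l (j : 'I_d), rmem s' A (l * d + j) =
  if (l == l0) && (j < i)%N then r 0 j else rmem s A (l * d + j).
apply: (exec_for (inv := inv) (m := d) (t := 1)) => //.
- by move=> s' fr; rewrite /= (frame_imem _ fr).
- by move=> l j; rewrite andbF.
- move=> i s1 lt_id fr i_eval inv1; split=> v.
  apply: wp_rstore; split=> // l j /=.
  have l0_eval : imem s1 x 0 = l0.
    by rewrite (frame_imem _ fr) // !inE negb_or x_neq.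
  rewrite i_eval l0_eval (frame_imem _ fr) // d_eval.
  rewrite update_same row_index_eq // inv1 ltnS [in RHS]leq_eqVlt.
  have [->|] //= := eqVneq l l0.
  have [j_eq|//] := eqVneq (nat_of_ord j) i.
  by apply: e_eval => //; rewrite ?j_eq // -j_eq inv1 eqxx j_eq ltnn.
- move=> s1 _ inv1 l; apply/rowP => j; rewrite !mxE inv1 ltn_ord andbT.
  by case: eqP => // _; rewrite mxE.
Qed.

End Rows.

Section Input.
Variables (R : realType) (n d k : nat) (X : 'I_n -> 'rV[R]_d) (eps : R).
Implicit Types (s : state R) (c : cmd).

Definition input s : Prop :=
  [/\ [/\ imem s dims 0 = n, imem s dims 1 = d & imem s dims 2 = k],
      forall x : 'I_n, mem_row d points_arr s x = X x & rmem s eps_var 0 = eps].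

Definition keeps_input c : bool :=
  [&& dims \notin iwrites c, points_arr \notin rwrites c
    & eps_var \notin rwrites c].

Lemma input_frame c s s' : frame c s s' -> keeps_input c -> input s -> input s'.
Proof.
move=> fr /and3P[dims_out points_out eps_out] [sizes X_eval eps_eval].
by split=> [|x|];
  rewrite ?(mem_row_frame _ _ fr) ?(frame_rmem _ fr) ?(frame_imem _ fr).
Qed.

End Input.

Section Seed.
Variables (R : realType) (orc : nat -> nat -> bool) (Q E : state R -> Prop).
Variables (n d k : nat) (X : 'I_n -> 'rV[R]_d) (eps : R).
Implicit Types (s : state R) (v : R) (b : 'I_n -> 'I_n).

Local Notation exec := (exec orc Q E).
Local Notation wp := (wp orc Q E).
Local Notation input := (input k X eps).

Lemma reassign_spec test s (closer := beval s test) (p := imem s point_var 0) :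
  exec 4 (reassign_cmd test) s (fun s' => forall y,
    imem s' anchor_arr y =
      (if closer && (y == p) then imem s drawn_var 0
       else imem s anchor_arr y) /\
    rmem s' dist_arr y =
      (if closer && (y == p) then rmem s sq_var 0 else rmem s dist_arr y)).
Proof.
split=> v; apply: wp_if; rewrite -/closer; case: closer; last exact: wp_skip.
apply: (wp_leq (t := (1 + 1).+1)) => //.
by apply: wp_seq; apply: wp_rstore; apply: wp_istore.
Qed.

Lemma update_spec test (closer : pred 'I_n) (a : 'I_n) s :
  input s -> imem s drawn_var 0 = a ->
  (forall (x : 'I_n) s', frame (update_cmd test) s s' ->
     imem s' point_var 0 = x -> rmem s' dist_arr x = rmem s dist_arr x ->
     rmem s' sq_var 0 = sqdist (X x) (X a) -> beval s' test = closer x) ->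
  exec (n * (d * 4 + 13) + 3) (update_cmd test) s (fun s' => forall x : 'I_n,
    imem s' anchor_arr x = (if closer x then val a else imem s anchor_arr x) /\
    rmem s' dist_arr x =
      (if closer x then sqdist (X x) (X a) else rmem s dist_arr x)).
Proof.
move=> inp a_eval test_eval; have [[n_eval _ _] _ _] := inp.
pose inv i s' := forall x : 'I_n,
  imem s' anchor_arr x =
    (if (x < i)%N && closer x then val a else imem s anchor_arr x) /\
  rmem s' dist_arr x =
    (if (x < i)%N && closer x then sqdist (X x) (X a) else rmem s dist_arr x).
apply: (exec_for (inv := inv) (m := n) (t := d * 4 + 10)) => //.
- by move=> s' fr; rewrite /= (frame_imem _ fr).
- move=> i s1 lt_in fr1 i_eval inv1; split=> v; pose x := Ordinal lt_in.
  have [[_ d_eval1 _] X_eval1 _] := input_frame fr1 isT inp.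
  have -> : (d * 4 + 10 = (d * 4 + 5 + 4).+1)%N by lia.
  apply: wp_seq; apply: (wp_exec (dist_spec (A := points_arr) (x := point_var)
    (y := drawn_var) _ _ _ isT isT isT d_eval1)) => s2 fr2 sq_eval.
  have fr02 := frame_extend fr1 fr2 isT.
  have i_eval2 : imem s2 point_var 0 = i by rewrite (frame_imem _ fr2).
  have a_eval2 : imem s2 drawn_var 0 = a by rewrite (frame_imem _ fr02).
  rewrite i_eval (frame_imem _ fr1) // a_eval (X_eval1 x) X_eval1 in sq_eval.
  have test_eval2 : beval s2 test = closer x.
    apply: test_eval => //; rewrite (frame_rmem _ fr2) //.
    by have [_ ->] := inv1 x; rewrite ltnn.
  apply: wp_exec (reassign_spec _ _) _ => s3 _ new; split=> // y.
  have [anchor_y dist_y] := inv1 y; have [] := new y.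
  rewrite test_eval2 i_eval2 a_eval2 sq_eval.
  rewrite (frame_imem _ fr2) // (frame_rmem _ fr2) //= update_other //.
  rewrite anchor_y dist_y ltnS [(y <= i)%N]leq_eqVlt => -> ->.
  have [y_eq|_] := eqVneq (nat_of_ord y) i; last by rewrite andbF.
  have -> : y = x by apply: val_inj.
  by rewrite ltnn andbT; case: (closer x).
- by move=> s1 _ inv1 x; have := inv1 x; rewrite ltn_ord.
lia.
Qed.

End Seed.

Section PrefixSums.
Variables (R : realType) (n : nat).
Implicit Type w : 'I_n -> R.

Definition prefix_sum w i : R := \sum_(x : 'I_n | (x < i)%N) w x.

Lemma prefix_sum0 w : prefix_sum w 0 = 0.
Proof. by rewrite /prefix_sum big_pred0. Qed.

Lemma prefix_sumS w (x : 'I_n) : prefix_sum w x.+1 = prefix_sum w x + w x.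
Proof.
rewrite /prefix_sum (bigD1 x) //= addrC; congr (_ + _); apply: eq_bigl => y.
by rewrite ltnS [RHS]ltn_neqAle andbC.
Qed.

Lemma prefix_sum_all w : prefix_sum w n = \sum_x w x.
Proof. by apply: eq_bigl => x; rewrite ltn_ord. Qed.

Lemma prefix_sum_ge0 w i : (forall x, 0 <= w x) -> 0 <= prefix_sum w i.
Proof. by move=> w_ge0; apply: sumr_ge0. Qed.

End PrefixSums.

Section Sample.
Variables (R : realType) (n : nat) (w G : 'I_n -> R).
Hypothesis w_ge0 : forall x, 0 <= w x.

Local Notation S := (\sum_x w x).

(* The expected value of [G] at the point drawn eventually, if [x] is the
   current point after the first [i] points. *)
Definition reservoir i x : R :=
  if S == 0 then G x
  else prefix_sum w i / S * G x + \sum_(y : 'I_n | (i <= y)%N) w y / S * G y.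

Lemma reservoir0 i0 : reservoir 0 i0 = \sum_x sample_law i0 w x * G x.
Proof.
rewrite /reservoir /sample_law; case: eqP => _; last first.
  by rewrite prefix_sum0 !mul0r add0r.
rewrite (bigD1 i0) //= eqxx mul1r big1 ?addr0 // => x /negbTE ->.
by rewrite mul0r.
Qed.

Lemma reservoir_all x : reservoir n x = G x.
Proof.
rewrite /reservoir prefix_sum_all; case: eqP => // /eqP S_neq0.
by rewrite divff // mul1r big_pred0 ?addr0 // => y; rewrite leqNgt ltn_ord.
Qed.

Lemma reservoirS (x y : 'I_n) (p := w y / prefix_sum w y.+1) :
  reservoir y x = p * reservoir y.+1 y + (1 - p) * reservoir y.+1 x.
Proof.
rewrite /p /reservoir prefix_sumS; set T := S; have [S0|S_neq0] := eqVneq T 0.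
  have -> : w y = 0 by apply: (psumr_eq0P (fun x _ => w_ge0 x) S0).
  by rewrite !mul0r add0r subr0 mul1r.
rewrite (bigD1 y) //= [X in _ + (_ + X)](_ : _ =
    \sum_(z : 'I_n | (y < z)%N) w z / S * G z); last first.
  by apply: eq_bigl => z; rewrite [RHS]ltn_neqAle andbC eq_sym.
set rest := \sum_(z | _) _.
have [prefix0|prefix_neq0] := eqVneq (prefix_sum w y + w y) 0; last first.
  by field; rewrite S_neq0 prefix_neq0.
have := prefix_sum_ge0 y w_ge0; have := w_ge0 y => wy_ge0 prefix_ge0.
have -> : w y = 0 by lra.
have -> : prefix_sum w y = 0 by lra.
by rewrite !(mul0r, add0r, subr0, mul1r).
Qed.

Variables (orc : nat -> nat -> bool) (Q E : state R -> Prop).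
Variable i0 : 'I_n.
Hypothesis i0_eq0 : val i0 = 0.

Lemma sample_spec A s Post :
  A != total_var -> imem s dims 0 = n -> (forall x : 'I_n, rmem s A x = w x) ->
  (forall s' (x : 'I_n), imem s' drawn_var 0 = x -> Post s' (G x)) ->
  wp orc Q E (n * 9 + 7) (sample_cmd A) s (\sum_x sample_law i0 w x * G x) Post.
Proof.
move=> A_neq n_eval w_eval post; rewrite -reservoir0.
have -> : (n * 9 + 7 = (1 + (1 + (n * 9 + 3)).+1).+1)%N by lia.
apply: wp_seq; apply: wp_rstore; apply: wp_seq; apply: wp_istore.
pose inv i s' v := rmem s' total_var 0 = prefix_sum w i /\
  exists2 x : 'I_n, imem s' drawn_var 0 = x & v = reservoir i x.
apply: (wp_for (inv := inv) (m := n) (t := (1 + (1 + 2).+1).+1)) => //.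
- by move=> s' fr; rewrite /= (frame_imem _ fr).
- by split; [rewrite prefix_sum0 | exists i0].
- move=> i s1 _ lt_in fr i_eval [sum_eval [x x_eval ->]].
  pose y := Ordinal lt_in.
  have weight_eval : rmem s1 A i = w y.
    by rewrite (frame_rmem _ fr) ?inE //= update_other // (w_eval y).
  apply: wp_seq; apply: wp_rstore.
  rewrite /= i_eval sum_eval weight_eval -(prefix_sumS w y).
  set p := prefix_sum w y.+1; have p_ge0 : 0 <= p := prefix_sum_ge0 _ w_ge0.
  have wy_le : w y <= p by rewrite /p prefix_sumS lerDr prefix_sum_ge0.
  apply: wp_seq; apply: (wp_flip _ _ _ (v1 := reservoir i.+1 y)
    (v2 := reservoir i.+1 x)).
  + apply: wp_if; apply: wp_istore; split=> //.
    by exists y => //=; rewrite i_eval.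
  + by apply: wp_if; apply: wp_skip => //; split=> //; exists x.
  rewrite /= i_eval update_other // update_same eqxx weight_eval.
  rewrite /clamp01 max_r ?divr_ge0 // min_r; first by rewrite (reservoirS x y).
  have [p0|p_neq0] := eqVneq p 0; first by rewrite p0 invr0 mulr0.
  by rewrite ler_pdivrMr ?mul1r // lt_def p_neq0.
by move=> s1 _ [_ [x x_eval ->]]; rewrite reservoir_all; apply: post.
Qed.

End Sample.

Section Anchors.
Variables (R : realType) (orc : nat -> nat -> bool) (Q E : state R -> Prop).
Variables (n d k : nat) (X : 'I_n -> 'rV[R]_d) (eps : R) (i0 : 'I_n).
Hypothesis i0_eq0 : val i0 = 0.
Implicit Types (s : state R) (b : 'I_n -> 'I_n) (x a : 'I_n).

Local Notation exec := (exec orc Q E).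
Local Notation input := (input k X eps).

Definition anchors b s : Prop :=
  forall x, imem s anchor_arr x = b x /\ rmem s dist_arr x = anchor_dist X b x.

Lemma anchors_frame c b s s' : frame c s s' -> anchor_arr \notin iwrites c ->
  dist_arr \notin rwrites c -> anchors b s -> anchors b s'.
Proof.
move=> fr anchor_out dist_out b_s x; have [anchor_x dist_x] := b_s x.
by rewrite (frame_imem _ fr) // (frame_rmem _ fr).
Qed.

Lemma first_anchor_spec a s : input s -> imem s drawn_var 0 = a ->
  exec (n * (d * 4 + 13) + 3) (update_cmd (BLeI (ICst 0) (ICst 0))) s
    (anchors (fun=> a)).
Proof.
by move=> inp a_eval; apply: (update_spec (closer := xpredT) _ _ _ inp a_eval).
Qed.

Lemma add_anchor_spec b a s :
  input s -> imem s drawn_var 0 = a -> anchors b s ->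
  exec (n * (d * 4 + 13) + 3) (update_cmd closer_to_drawn) s
    (anchors (add_anchor X b a)).
Proof.
move=> inp a_eval b_s; pose closer x := sqdist (X x) (X a) <= anchor_dist X b x.
apply: exec_mono (update_spec (closer := closer) _ _ _ inp a_eval _) _.
  move=> x s1 _ x_eval dist_eval sq_eval /=.
  by rewrite sq_eval x_eval dist_eval; have [_ ->] := b_s x.
move=> s1 _ new x; have [anchor_x dist_x] := b_s x; have [-> ->] := new x.
rewrite anchor_x dist_x anchor_dist_add minEle /add_anchor /closer.
by case: ifP.
Qed.

Lemma seed_spec s (h : ('I_n -> 'I_n) -> R) Post :
  input s -> imem s drawn_var 0 = 0 ->
  (forall s' xs (b := foldl (add_anchor X) (fun=> i0) xs),
     size xs = (8 * k)%N -> anchors b s' -> Post s' (h b)) ->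
  wp orc Q E (seed_time n d k) seed_cmd s (seeding_expect X i0 (8 * k) h) Post.
Proof.
move=> inp drawn0 post; set t := (n * (d * 4 + 13) + 3)%N; apply: wp_leq.
  apply: wp_seq; apply: (wp_exec (first_anchor_spec (a := i0) inp _)).
    by rewrite drawn0 i0_eq0.
  move=> s1 fr1 b_s1; have inp1 := input_frame fr1 isT inp.
  have [[_ _ k_eval1] _ _] := inp1.
  apply: (wp_for_chain (T := 8 * k * ((n * 9 + 7 + t).+1 + 3) + 3)
    (repr := anchors) (m := (8 * k)%N) (t := (n * 9 + 7 + t).+1)) => //.
    by move=> s2 fr2; rewrite /= (frame_imem _ fr2) // k_eval1.
  move=> i s2 b g _ fr2 b_s2; have inp2 := input_frame fr2 isT inp1.
  have [[n_eval2 _ _] _ _] := inp2.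
  apply: wp_seq; apply: wp_frame.
  apply: (sample_spec (G := fun a => g (add_anchor X b a))) => //.
  - by move=> x; apply: anchor_dist_ge0.
  - by move=> x; have [_ ->] := b_s2 x.
  move=> s3 a a_eval fr3; have inp3 := input_frame fr3 isT inp2.
  have b_s3 := anchors_frame fr3 isT isT b_s2.
  by apply: wp_exec (add_anchor_spec inp3 a_eval b_s3) _ => s4 _ b_s4; exists a.
by rewrite /t /seed_time; lia.
Qed.

Lemma cells_spec b s : input s -> anchors b s -> rmem s cost_var 0 = 0 ->
  (forall p, imem s cell_arr p = 0) ->
  exec (n * 6 + 3) cells_cmd s (fun s' =>
    rmem s' cost_var 0 = anchor_cost X b /\
    forall p : 'I_n, (imem s' cell_arr p)%:R = fiber_size R b p).
Proof.
move=> [[n_eval _ _] _ _] b_s cost0 cell0.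
pose inv i s' := rmem s' cost_var 0 = prefix_sum (anchor_dist X b) i /\
  forall p : 'I_n,
    (imem s' cell_arr p)%:R = prefix_sum (fun x => (b x == p)%:R : R) i.
apply: (exec_for (inv := inv) (m := n) (t := (1 + 1).+1)) => //.
- by move=> s' fr; rewrite /= (frame_imem _ fr).
- by split=> [|p]; rewrite ?prefix_sum0 // /= update_other // cell0.
- move=> i s1 lt_in fr i_eval [cost_eval cell_eval]; pose x := Ordinal lt_in.
  have [anchor_x dist_x] := anchors_frame fr isT isT b_s x.
  split=> v; apply: wp_seq; apply: wp_rstore; apply: wp_istore; split=> //.
  split=> [|p]; first by rewrite /= i_eval dist_x cost_eval (prefix_sumS _ x).
  rewrite /= update_other // update_same i_eval anchor_x.
  rewrite (prefix_sumS _ x) -cell_eval.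
  rewrite (inj_eq val_inj) [p == _]eq_sym addn1.
  by case: eqP => [->|_]; rewrite ?natr1 // addr0.
- move=> s1 _ [cost_eval cell_eval]; split=> [|p].
    by rewrite cost_eval prefix_sum_all.
  rewrite cell_eval prefix_sum_all /fiber_size -sum1_card natr_sum.
  rewrite [RHS]big_mkcond.
  by apply: eq_bigr => x _; rewrite inE; case: eqP.
Qed.

Lemma weigh_spec b s :
  input s -> anchors b s -> rmem s cost_var 0 = anchor_cost X b ->
  (forall p : 'I_n, (imem s cell_arr p)%:R = fiber_size R b p) ->
  exec (n * 4 + 3) weigh_cmd s
    (fun s' => forall x, rmem s' weight_arr x = anchor_weight X b x).
Proof.
move=> [[n_eval _ _] _ _] b_s cost_eval cell_eval.
pose inv i s' :=
  forall x, (x < i)%N -> rmem s' weight_arr x = anchor_weight X b x.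
apply: (exec_for (inv := inv) (m := n) (t := 1)) => //.
- by move=> s' fr; rewrite /= (frame_imem _ fr).
- move=> i s1 lt_in fr i_eval inv1; pose x := Ordinal lt_in.
  have [anchor_x dist_x] := anchors_frame fr isT isT b_s x.
  split=> v; apply: wp_rstore; split=> // y.
  rewrite /= update_same i_eval ltnS leq_eqVlt.
  have [y_eq _|_ /inv1 //] := eqVneq.
  have -> : y = x by apply: val_inj.
  rewrite anchor_x dist_x (frame_rmem _ fr) // (frame_imem _ fr) //.
  by rewrite cost_eval cell_eval div1r.
- by move=> s1 _ inv1 x; apply: inv1.
Qed.

End Anchors.

Section FirstSeen.
Variable T : eqType.
Implicit Types (x y : T) (s : seq T).

(* The elements of [s] in the order of their last occurrences, from right to
   left: [s] lists the most recent element first. *)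
Definition first_seen s : seq T := rev (undup s).

Lemma mem_first_seen s : first_seen s =i s.
Proof. by move=> x; rewrite mem_rev mem_undup. Qed.

Lemma first_seen_uniq s : uniq (first_seen s).
Proof. by rewrite rev_uniq undup_uniq. Qed.

Lemma first_seen_cons x s :
  first_seen (x :: s) =
  if x \in s then first_seen s else rcons (first_seen s) x.
Proof. by rewrite /first_seen /=; case: ifP => // _; rewrite rev_cons. Qed.

Lemma index_first_seen_cons x s y : y \in x :: s ->
  index y (first_seen (x :: s)) = index y (first_seen s).
Proof.
rewrite first_seen_cons; case: ifP => // x_notin; rewrite inE -cats1 index_cat.
rewrite mem_first_seen => /orP[/eqP ->|->] //.
by rewrite x_notin /= eqxx addn0 memNindex ?mem_first_seen ?x_notin.
Qed.

Lemma size_first_seen_cons x s : size (first_seen (x :: s)) =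
  maxn (size (first_seen s)) (index x (first_seen s)).+1.
Proof.
rewrite first_seen_cons -mem_first_seen; case: ifP => x_in.
  by apply/esym/maxn_idPl; rewrite index_mem.
by rewrite size_rcons memNindex ?x_in //; apply/esym/maxn_idPr.
Qed.

Lemma index_first_seen_eq s x y : x \in s ->
  (index y (first_seen s) == index x (first_seen s)) = (y == x).
Proof.
rewrite -mem_first_seen => x_in; apply/eqP/eqP => [index_eq|-> //].
have y_in : y \in first_seen s by rewrite -index_mem index_eq index_mem.
by rewrite -(nth_index x y_in) index_eq nth_index.
Qed.

End FirstSeen.

Section Slots.
Variables (R : realType) (Q E : state R -> Prop).
Variables (n d k : nat) (X : 'I_n -> 'rV[R]_d) (eps : R).
Variables (f : 'I_n -> 'I_k) (w : 'I_n -> R).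
Implicit Types (s : state R) (a x r : 'I_n) (xs : seq 'I_n).

Local Notation exec := (exec (oracle f) Q E).
Local Notation input := (input k X eps).

Definition labels xs : seq 'I_k := first_seen (map f xs).
Definition nslots xs : nat := size (labels xs).
Definition slot_of xs x : nat := index (f x) (labels xs).

Definition slot_table xs s : Prop :=
  imem s nslots_var 0 = nslots xs /\
  forall l, (l < nslots xs)%N ->
    exists2 r : 'I_n, imem s rep_arr l = r & slot_of xs r = l.

Definition slot_sums xs s : Prop :=
  (forall l, rmem s mass_arr l = \sum_(x <- xs | slot_of xs x == l) (w x)^-1) /\
  forall l, mem_row d moment_arr s l =
    \sum_(x <- xs | slot_of xs x == l) (w x)^-1 *: X x.

Lemma slot_table_frame c xs s s' : frame c s s' ->
  nslots_var \notin iwrites c -> rep_arr \notin iwrites c ->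
  slot_table xs s -> slot_table xs s'.
Proof.
move=> fr n_out rep_out [n_eval rep_eval].
split=> [|l /rep_eval[r r_eval r_slot]].
  by rewrite (frame_imem _ fr).
by exists r; rewrite // (frame_imem _ fr).
Qed.

Lemma slot_sums_frame c xs s s' : frame c s s' ->
  mass_arr \notin rwrites c -> moment_arr \notin rwrites c ->
  slot_sums xs s -> slot_sums xs s'.
Proof.
move=> fr mass_out moment_out [mass_eval moment_eval].
by split=> l; rewrite ?(frame_rmem _ fr) ?(mem_row_frame _ _ fr).
Qed.

Lemma nslots_le xs : (nslots xs <= k)%N.
Proof.
by rewrite /nslots -(card_uniqP (first_seen_uniq _)) -[leqRHS]card_ord max_card.
Qed.

Lemma slot_of_le xs x : (slot_of xs x <= nslots xs)%N.
Proof. exact: index_size. Qed.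

Lemma slot_of_eq xs x r : (slot_of xs r < nslots xs)%N ->
  (slot_of xs x == slot_of xs r) = (f r == f x).
Proof.
by rewrite index_mem mem_first_seen => ?; rewrite index_first_seen_eq // eq_sym.
Qed.

Lemma slot_of_cons a xs x : f x \in map f (a :: xs) ->
  slot_of (a :: xs) x = slot_of xs x.
Proof. exact: index_first_seen_cons. Qed.

Lemma sum_slot_cons (V : nmodType) (F : 'I_n -> V) a xs l :
  \sum_(x <- a :: xs | slot_of (a :: xs) x == l) F x =
  (if slot_of xs a == l then F a else 0) +
  \sum_(x <- xs | slot_of xs x == l) F x.
Proof.
rewrite big_cons slot_of_cons ?mem_head //.
have -> : \sum_(x <- xs | slot_of (a :: xs) x == l) F x =
    \sum_(x <- xs | slot_of xs x == l) F x.
  rewrite big_seq_cond [RHS]big_seq_cond; apply: eq_bigl => x.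
  have [x_in|//] := boolP (x \in xs).
  by rewrite slot_of_cons // inE map_f ?orbT.
by case: ifP => _; rewrite ?add0r.
Qed.

Lemma sum_slot_label (V : nmodType) (F : 'I_n -> V) xs j :
  has (fun x => f x == j) xs ->
  \sum_(x <- xs | slot_of xs x == index j (labels xs)) F x =
  \sum_(x <- xs | f x == j) F x.
Proof.
move=> /hasP[y y_in /eqP fy]; apply: eq_bigl => x.
by rewrite /slot_of index_first_seen_eq // -fy map_f.
Qed.

Lemma oracle_ord (x y : 'I_n) : oracle f x y = (x != y) && (f x == f y).
Proof. by rewrite /oracle !valK. Qed.

Lemma same_slot_eval s r a :
  imem s answer_var 0 = oracle f r a -> imem s drawn_var 0 = a ->
  imem s rep_arr (imem s probe_var 0) = r ->
  beval s same_slot = (f r == f a).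
Proof.
rewrite /= => -> -> ->; rewrite oracle_ord negb_and !negbK lt0b -eqn_leq.
rewrite (inj_eq val_inj).
by have [->|_] := eqVneq r a; rewrite ?eqxx // orbF.
Qed.

Lemma locate_spec xs a s : slot_table xs s -> imem s drawn_var 0 = a ->
  exec (k * 7 + 5) locate_cmd s (fun s' =>
    imem s' slot_var 0 = slot_of xs a /\ (nqueries s' <= nqueries s + k)%N).
Proof.
move=> [n_eval rep_eval] a_eval; have le_k := nslots_le xs.
set m := nslots xs in n_eval rep_eval le_k; split=> v.
apply: (wp_leq (t := (1 + (m * 7 + 3)).+1)); last lia.
apply: wp_seq; apply: wp_istore; rewrite /= n_eval.
pose inv i s' :=
  imem s' slot_var 0 = (if slot_of xs a < i then slot_of xs a else m)%N /\
  nqueries s' = (nqueries s + i)%N.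
apply: exec_const.
apply: (exec_for (inv := inv) (m := m) (t := (1 + 2).+1)) => //.
- by move=> s1 fr; rewrite /= (frame_imem _ fr).
- by split; rewrite ?addn0.
- move=> i s1 lt_im fr i_eval [slot_eval q_eval].
  have [r r_eval r_slot] := rep_eval i lt_im.
  have a_eval1 : imem s1 drawn_var 0 = a by rewrite (frame_imem _ fr).
  have r_eval1 : imem s1 rep_arr (imem s1 probe_var 0) = r.
    by rewrite i_eval (frame_imem _ fr) // r_eval.
  split=> v'; apply: wp_seq; apply: wp_query; apply: wp_if.
  rewrite (same_slot_eval (r := r) (a := a)) //; last first.
    by rewrite /= r_eval1 a_eval1.
  have -> : (f r == f a) = (slot_of xs a == i).
    by rewrite -r_slot slot_of_eq ?r_slot.
  have [slot_eq|slot_neq] := eqVneq.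
    apply: wp_istore; split=> //; split; last by rewrite /= q_eval addnS.
    by rewrite /= update_other // update_same slot_eq ltnSn.
  apply: wp_skip => //; split=> //; split; last by rewrite /= q_eval addnS.
  rewrite /= !update_other // slot_eval.
  by rewrite ltnS [in RHS]leq_eqVlt (negbTE slot_neq).
- move=> s1 _ [-> ->]; split; last by rewrite leq_add2l.
  have := slot_of_le xs a; rewrite -/m leq_eqVlt.
  by move=> /orP[/eqP ->|->]; rewrite ?ltnn.
Qed.

Lemma open_spec xs a s : slot_table xs s -> imem s drawn_var 0 = a ->
  imem s slot_var 0 = slot_of xs a ->
  exec 3 open_cmd s (slot_table (a :: xs)).
Proof.
move=> [n_eval rep_eval] a_eval slot_eval.
have nslotsE := size_first_seen_cons (f a) (map f xs).
split=> v; apply: (wp_leq (t := (1 + 1).+1)) => //.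
apply: wp_seq; apply: wp_istore; apply: wp_istore; split=> //; split=> [|l].
  rewrite /= update_same eqxx !update_other // n_eval slot_eval addn1 -maxnE.
  by rewrite -nslotsE.
rewrite /= update_other // update_same slot_eval; have [-> _|l_neq] := eqVneq.
  by exists a; rewrite ?a_eval // slot_of_cons ?mem_head.
rewrite /nslots nslotsE leq_max ltnS.
rewrite [in X in _ || X]leq_eqVlt (negbTE l_neq) /=.
move=> l_lt; have {}l_lt : (l < nslots xs)%N.
  by case/orP: l_lt => // /leq_trans; apply; apply: slot_of_le.
have [r r_eval r_slot] := rep_eval l l_lt; exists r => //.
rewrite slot_of_cons //= inE; apply/orP; right.
by rewrite -(mem_first_seen (map f xs)) -index_mem [index _ _]r_slot.
Qed.

Lemma add_point_spec xs a s :
  input s -> slot_sums xs s -> imem s drawn_var 0 = a ->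
  imem s slot_var 0 = slot_of xs a -> rmem s weight_arr a = w a ->
  exec (d * 4 + 5) add_point_cmd s (slot_sums (a :: xs)).
Proof.
move=> inp [mass_eval moment_eval] a_eval slot_eval weight_eval.
have [[_ d_eval _] X_eval _] := inp; set l0 := slot_of xs a in slot_eval *.
have -> : (d * 4 + 5 = (1 + (d * 4 + 3)).+1)%N by lia.
split=> v; apply: wp_seq; apply: wp_rstore.
rewrite /= slot_eval a_eval weight_eval div1r; set s1 := set_real _ _ _ _.
pose row := mem_row d moment_arr s l0 + (w a)^-1 *: X a.
apply: (wp_exec (row_spec (d := d) (r := row) _ _ _ _ _ _)) => //
  [s2 j fr j_eval row_j|s2 fr row_eval].
  have a_eval2 : imem s2 drawn_var 0 = a by rewrite (frame_imem _ fr).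
  have slot_eval2 : imem s2 slot_var 0 = l0 by rewrite (frame_imem _ fr).
  have d_eval2 : imem s2 dims 1 = d by rewrite (frame_imem _ fr).
  rewrite /= in row_j; rewrite slot_eval in row_j.
  rewrite /= slot_eval2 a_eval2 d_eval2 j_eval row_j !mxE -X_eval mxE.
  by rewrite !(frame_rmem _ fr) //= !update_other // weight_eval mulrC.
split=> //; split=> l; rewrite sum_slot_cons eq_sym.
  rewrite (frame_rmem _ fr) //= update_same.
  case: eqP => [->|_]; last by rewrite add0r.
  by rewrite -/l0 mass_eval addrC.
rewrite row_eval /= slot_eval.
case: eqP => [->|_]; last by rewrite add0r -moment_eval.
by rewrite -/l0 /row moment_eval addrC.
Qed.

Lemma place_spec xs a s : input s -> slot_table xs s -> slot_sums xs s ->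
  imem s drawn_var 0 = a -> rmem s weight_arr a = w a ->
  exec (k * 7 + d * 4 + 15) place_cmd s (fun s' =>
    [/\ slot_table (a :: xs) s', slot_sums (a :: xs) s'
      & (nqueries s' <= nqueries s + k)%N]).
Proof.
move=> inp table sums a_eval weight_eval; split=> v.
apply: (wp_leq (t := (k * 7 + 5 + (3 + (d * 4 + 5)).+1).+1)); last lia.
apply: wp_seq; apply: (wp_exec (locate_spec table a_eval)).
move=> s1 fr1 [slot_eval1 q_le].
have table1 := slot_table_frame fr1 isT isT table.
have a_eval1 : imem s1 drawn_var 0 = a by rewrite (frame_imem _ fr1).
apply: wp_seq; apply: (wp_exec (open_spec table1 a_eval1 slot_eval1)).
move=> s2 fr2 table2.
have inp2 := input_frame fr2 isT (input_frame fr1 isT inp).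
have sums2 := slot_sums_frame fr2 isT isT (slot_sums_frame fr1 isT isT sums).
have a_eval2 : imem s2 drawn_var 0 = a by rewrite (frame_imem _ fr2).
have slot_eval2 : imem s2 slot_var 0 = slot_of xs a.
  by rewrite (frame_imem _ fr2).
have weight_eval2 : rmem s2 weight_arr a = w a.
  by rewrite (frame_rmem _ fr2) ?(frame_rmem _ fr1).
apply: (wp_exec (add_point_spec inp2 sums2 a_eval2 slot_eval2 weight_eval2)).
move=> s3 fr3 sums3; split=> //; split=> //.
  exact: slot_table_frame fr3 isT isT table2.
by rewrite (frame_queries fr3 isT) (frame_queries fr2 isT).
Qed.

Variable i0 : 'I_n.
Hypothesis i0_eq0 : val i0 = 0.
Hypothesis w_gt0 : forall x, 0 < w x.

Lemma recover_spec m s (h : seq 'I_n -> R) Post :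
  input s -> (forall x : 'I_n, rmem s weight_arr x = w x) ->
  imem s ndraws_var 0 = m -> slot_table [::] s -> slot_sums [::] s ->
  (forall s' xs, size xs = m -> slot_table xs s' -> slot_sums xs s' ->
     (nqueries s' <= nqueries s + m * k)%N -> Post s' (h xs)) ->
  wp (oracle f) Q E (m * (n * 9 + k * 7 + d * 4 + 26) + 3) recover_cmd s
    (iid_expect (sample_law i0 w) m h [::]) Post.
Proof.
move=> inp weight_eval m_eval table sums post.
pose repr xs s' := [/\ slot_table xs s', slot_sums xs s'
  & (nqueries s' <= nqueries s + size xs * k)%N].
apply: (wp_for_chain (repr := repr) (m := m)
  (t := (n * 9 + 7 + (k * 7 + d * 4 + 15)).+1)) => //; last 1 first.
- lia.
- by move=> s1 fr; rewrite /= (frame_imem _ fr).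
- by split; rewrite ?addn0.
- move=> i s1 xs g _ fr1 [table1 sums1 q_le1].
  have inp1 := input_frame fr1 isT inp.
  have [[n_eval1 _ _] _ _] := inp1.
  have weight_eval1 x : rmem s1 weight_arr x = w x.
    by rewrite (frame_rmem _ fr1).
  apply: wp_seq; apply: wp_frame.
  apply: (sample_spec (G := fun a => g (push xs a))) => // [x|s2 a a_eval fr2].
    exact: ltW.
  have inp2 := input_frame fr2 isT inp1.
  have table2 := slot_table_frame fr2 isT isT table1.
  have sums2 := slot_sums_frame fr2 isT isT sums1.
  have weight_eval2 : rmem s2 weight_arr a = w a by rewrite (frame_rmem _ fr2).
  apply: wp_exec (place_spec inp2 table2 sums2 a_eval weight_eval2) _.
  move=> s3 _ [table3 sums3 q_le3]; exists a => //; split=> //=.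
  rewrite mulSn addnCA addnC (leq_trans q_le3) // leq_add2r.
  by rewrite (frame_queries fr2 isT).
- move=> s1 ys xs sz_ys [table1 sums1 q_le1].
  have sz_xs : size xs = m by rewrite size_foldl_push addn0.
  by apply: post; rewrite // -sz_xs.
Qed.

End Slots.

Section Dedup.
Variables (R : realType) (d : nat) (d_gt0 : (0 < d)%N).
Variables (C : nat -> 'rV[R]_d) (B : R).
Implicit Types i k l : nat.

Let coord0 : 'I_d := Ordinal d_gt0.

Definition repeats i : bool := C i \in mkseq C i.

Definition dedup i : 'rV[R]_d :=
  if repeats i then \row_j (if j == coord0 then B + i%:R else C i 0 j) else C i.

Lemma dedup_neq i k : (i < k)%N -> C i 0 coord0 < B -> C k 0 coord0 < B ->
  dedup i != dedup k.
Proof.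
move=> lt_ik Ci_lt Ck_lt; have i_ge0 := ler0n R i; have k_ge0 := ler0n R k.
apply/eqP => eq_ik; have := congr1 (fun r : 'rV[R]_d => r 0 coord0) eq_ik.
move: eq_ik; rewrite /dedup.
case: (boolP (repeats i)) => _; case: (boolP (repeats k)) => k_new eq_ik;
  rewrite ?mxE ?eqxx.
- by move/addrI/eqP; rewrite eqr_nat ltn_eqF.
- lra.
- lra.
by case/negP: k_new; rewrite /repeats -eq_ik map_f // mem_iota.
Qed.

Lemma dedup_uniq k : (forall i, (i < k)%N -> C i 0 coord0 < B) ->
  uniq [seq dedup l | l : 'I_k].
Proof.
move=> C_lt; rewrite map_inj_uniq ?enum_uniq // => i j /eqP eq_ij.
apply/val_inj/eqP; apply: contraLR eq_ij; rewrite neq_ltn => /orP[lt_ij|lt_ji].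
  by apply: dedup_neq; rewrite ?C_lt.
by rewrite eq_sym; apply: dedup_neq; rewrite ?C_lt.
Qed.

Lemma mem_dedup k l : (l < k)%N -> C l \in [seq dedup l' | l' : 'I_k].
Proof.
move=> lt_lk; have exC : exists i, C i == C l by exists l.
case: (ex_minnP exC) => i /eqP C_eq i_min.
have lt_ik : (i < k)%N by apply: leq_ltn_trans (i_min l (eqxx _)) lt_lk.
apply/mapP; exists (Ordinal lt_ik); rewrite ?mem_enum // /dedup ifN //.
apply/mapP => -[l']; rewrite mem_iota /= => lt_l'i C_eq'.
by have := i_min l'; rewrite -C_eq' C_eq eqxx leqNgt lt_l'i => /(_ isT).
Qed.

End Dedup.

Lemma lt_sum_sqr (R : realType) (k : nat) (F : nat -> R) (i : nat) :
  (i < k)%N -> F i < 1 + \sum_(l < k) F l ^+ 2.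
Proof.
move=> lt_ik; rewrite (bigD1 (Ordinal lt_ik)) //=.
set rest := \sum_(l < k | _) _.
have : 0 <= rest by apply: sumr_ge0 => l _; apply: sqr_ge0.
have := sqr_ge0 (F i - 2^-1); rewrite sqrrB; lra.
Qed.

Section Output.
Variables (R : realType) (orc : nat -> nat -> bool) (Q E : state R -> Prop).
Variables (n d k : nat) (X : 'I_n -> 'rV[R]_d) (eps : R).
Implicit Types (s : state R).

Local Notation exec := (exec orc Q E).
Local Notation input := (input k X eps).

Definition number_of_draws (M : nat) : nat :=
  Num.truncn (M%:R * k%:R ^+ 3 / eps ^+ 3).

Lemma count_spec M s :
  0 < eps -> input s -> imem s ndraws_var 0 = 0 ->
  exec (number_of_draws M * 2 + 1) (count_cmd M) s
    (fun s' => imem s' ndraws_var 0 = number_of_draws M).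
Proof.
set m := number_of_draws M => eps_gt0 inp draws0; split=> v; rewrite addn1.
pose inv i s' v' := [/\ v' = v, (i <= m)%N & imem s' ndraws_var 0 = (m - i)%N].
apply: (wp_while (t := 1) (inv := inv)); last by rewrite /inv subnn leqnn.
move=> i s1 _ fr [-> le_im draws_eval].
have [[_ _ k_eval] _ eps_eval] := input_frame fr isT inp.
have -> : beval s1 (more_draws M) = (m - i < m)%N.
  rewrite /= draws_eval k_eval eps_eval addn1.
  rewrite truncn_gt_nat ler_pdivlMr ?exprn_gt0 //.
  by rewrite !natrM !exprS expr0 !mulr1.
case: ltnP => [lt_m|le_m]; last by split=> //; rewrite draws_eval; lia.
split; first lia.
apply: wp_istore; split=> //; first lia.
by rewrite /= update_same eqxx draws_eval; lia.
Qed.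

Definition slot_mean s l : 'rV[R]_d :=
  (rmem s mass_arr l)^-1 *: mem_row d moment_arr s l.

Lemma find_repeat_spec s (C := mem_row d mean_arr s) (i := imem s slot_var 0) :
  input s ->
  exec (i * (d * 4 + 11) + 5) find_repeat_cmd s
    (fun s' => imem s' repeat_var 0 = repeats C i).
Proof.
move=> inp.
have -> : (i * (d * 4 + 11) + 5 = (1 + (i * (d * 4 + 11) + 3)).+1)%N by lia.
split=> v; apply: wp_seq; apply: wp_istore; set s0 := set_int _ _ _ _.
have inp0 : input s0 by [].
apply: exec_const; apply: (exec_for (m := i) (t := (d * 4 + 5 + 2).+1)
  (inv := fun l s' => imem s' repeat_var 0 = (C i \in mkseq C l))) => //.
- by move=> s1 fr; rewrite /= (frame_imem _ fr).
- move=> l s1 _ fr l_eval rep_eval.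
  have [[_ d_eval1 _] _ _] := input_frame fr isT inp0.
  have i_eval1 : imem s1 slot_var 0 = i by rewrite (frame_imem _ fr).
  split=> v'; apply: wp_seq.
  apply: (wp_exec (dist_spec (A := mean_arr) (x := slot_var) (y := probe_var)
    _ _ _ isT isT isT d_eval1)) => s2 fr2 sq_eval.
  have row_eval l' : mem_row d mean_arr s1 l' = C l'.
    by rewrite (mem_row_frame _ _ fr).
  rewrite l_eval i_eval1 !row_eval in sq_eval.
  have test_eval : (rmem s2 sq_var 0 <= 0) = (C i == C l).
    by rewrite sq_eval -sqdist_eq0 eq_le sqdist_ge0 andbT.
  have rep_eval2 : imem s2 repeat_var 0 = (C i \in mkseq C l).
    by rewrite (frame_imem _ fr2).
  apply: wp_if; rewrite /= test_eval mkseqS mem_rcons inE; case: (C i == C l).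
    by apply: wp_istore.
  by apply: wp_skip.
lia.
Qed.

Hypothesis d_gt0 : (0 < d)%N.
Let coord0 : 'I_d := Ordinal d_gt0.

Lemma means_spec s : input s ->
  exec (k * (d * 4 + 8) + 5) means_cmd s (fun s' =>
    (forall l, (l < k)%N -> mem_row d mean_arr s' l = slot_mean s l) /\
    rmem s' bound_var 0 = 1 + \sum_(l < k) slot_mean s l 0 coord0 ^+ 2).
Proof.
move=> inp; have [[_ _ k_eval] _ _] := inp.
have -> : (k * (d * 4 + 8) + 5 = (1 + (k * (d * 4 + 8) + 3)).+1)%N by lia.
split=> v; apply: wp_seq; apply: wp_rstore; set s0 := set_real _ _ _ _.
have inp0 : input s0 by [].
pose inv i s' :=
  (forall l, (l < i)%N -> mem_row d mean_arr s' l = slot_mean s l) /\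
  rmem s' bound_var 0 = 1 + \sum_(l < i) slot_mean s l 0 coord0 ^+ 2.
apply: exec_const.
apply: (exec_for (inv := inv) (m := k) (t := (d * 4 + 3 + 1).+1)) => //.
- by move=> s1 fr; rewrite /= (frame_imem _ fr).
- by split=> //; rewrite big_ord0 addr0.
- move=> i s1 lt_ik fr i_eval [mean_eval bound_eval].
  have inp1 := input_frame fr isT inp0; have [[_ d_eval1 _] _ _] := inp1.
  split=> v'; apply: wp_seq.
  apply: (wp_exec (row_spec (r := slot_mean s i) _ _ _ _ d_eval1 _)) => //.
    move=> s2 j fr2 j_eval _.
    have i_eval2 : imem s2 slot_var 0 = i by rewrite (frame_imem _ fr2).
    have d_eval2 : imem s2 dims 1 = d by rewrite (frame_imem _ fr2).
    rewrite /= i_eval2 d_eval2 j_eval !mxE mulrC.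
    by rewrite !(frame_rmem _ fr2) // !(frame_rmem _ fr).
  move=> s2 fr2 row_eval; rewrite i_eval in row_eval.
  have i_eval2 : imem s2 slot_var 0 = i by rewrite (frame_imem _ fr2).
  have d_eval2 : imem s2 dims 1 = d by rewrite (frame_imem _ fr2).
  apply: wp_rstore; split=> //; split=> [l|].
    rewrite ltnS leq_eqVlt => lt_l; apply: etrans (row_eval l) _.
    by case: eqP lt_l => [->|_ /mean_eval].
  rewrite /= update_same eqxx (frame_rmem _ fr2) // bound_eval big_ord_recr /=.
  have := congr1 (fun r : 'rV[R]_d => r 0 coord0) (row_eval i).
  rewrite eqxx mxE /= => <-.
  by rewrite i_eval2 d_eval2 addrA expr2.
lia.
Qed.

Lemma move_repeat_spec s : input s ->
  exec 2 move_repeat_cmd s (fun s' => forall l, mem_row d centers_arr s' l =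
    if (l == imem s slot_var 0) && (0 < imem s repeat_var 0)%N
    then \row_j (if j == coord0 then rmem s bound_var 0 + l%:R
                 else mem_row d centers_arr s l 0 j)
    else mem_row d centers_arr s l).
Proof.
move=> inp; have [[_ d_eval _] _ _] := inp; split=> v; apply: wp_if => /=.
case: ltnP => _; last by apply: wp_skip => //; split=> // l; rewrite andbF.
apply: wp_rstore; split=> // l; apply/rowP => j.
rewrite andbT /= d_eval !mxE /= update_same -[0%N]/(nat_of_ord coord0).
rewrite row_index_eq // val_eqE.
by case: eqP => [->|_] /=; rewrite ?mxE //; case: ifP; rewrite ?mxE.
Qed.

Lemma dedup_step_spec s (C := mem_row d mean_arr s) (B := rmem s bound_var 0)
    (i := imem s slot_var 0) :
  input s ->
  exec (i * (d * 4 + 11) + d * 4 + 12)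
    (Seq find_repeat_cmd (Seq copy_mean_cmd move_repeat_cmd)) s
    (fun s' => forall l, mem_row d centers_arr s' l =
       if l == i then dedup d_gt0 C B i else mem_row d centers_arr s l).
Proof.
move=> inp; split=> v.
apply: (wp_leq (t := (i * (d * 4 + 11) + 5 + (d * 4 + 3 + 2).+1).+1)); last lia.
apply: wp_seq; apply: (wp_exec (find_repeat_spec inp)) => s1 fr1 rep_eval.
have inp1 := input_frame fr1 isT inp; have [[_ d_eval1 _] _ _] := inp1.
have i_eval1 : imem s1 slot_var 0 = i by rewrite (frame_imem _ fr1).
apply: wp_seq.
apply: (wp_exec (row_spec (r := C i) _ _ _ _ d_eval1 _)) => //.
  move=> s2 j fr2 j_eval _.
  have i_eval2 : imem s2 slot_var 0 = i by rewrite (frame_imem _ fr2).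
  have d_eval2 : imem s2 dims 1 = d by rewrite (frame_imem _ fr2).
  rewrite /= i_eval2 d_eval2 j_eval mxE.
  by rewrite (frame_rmem _ fr2) ?(frame_rmem _ fr1).
move=> s2 fr2; rewrite i_eval1 => row_eval.
have inp2 := input_frame fr2 isT inp1.
have i_eval2 : imem s2 slot_var 0 = i by rewrite (frame_imem _ fr2).
have rep_eval2 : imem s2 repeat_var 0 = repeats C i.
  by rewrite (frame_imem _ fr2).
have bound_eval2 : rmem s2 bound_var 0 = B.
  by rewrite (frame_rmem _ fr2) ?(frame_rmem _ fr1).
apply: (wp_exec (move_repeat_spec inp2)) => s3 _ moved; split=> // l.
rewrite moved i_eval2 rep_eval2 bound_eval2 row_eval lt0b.
rewrite (mem_row_frame _ _ fr1) // /dedup.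
by case: eqP => [->|//]; case: (repeats C i).
Qed.

Lemma dedup_spec s (C := mem_row d mean_arr s) (B := rmem s bound_var 0) :
  input s ->
  exec (k * (k * (d * 4 + 11) + d * 4 + 15) + 3) dedup_cmd s (fun s' =>
    forall l, (l < k)%N -> mem_row d centers_arr s' l = dedup d_gt0 C B l).
Proof.
move=> inp; have [[_ _ k_eval] _ _] := inp.
pose inv i s' :=
  forall l, (l < i)%N -> mem_row d centers_arr s' l = dedup d_gt0 C B l.
apply: (exec_for (inv := inv) (m := k)
  (t := k * (d * 4 + 11) + d * 4 + 12)) => //.
- by move=> s1 fr; rewrite /= (frame_imem _ fr).
- move=> i s1 lt_ik fr i_eval rows_eval; have inp1 := input_frame fr isT inp.
  have C_eval : mem_row d mean_arr s1 = C.
    by apply/funext => l; rewrite (mem_row_frame _ _ fr).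
  have B_eval : rmem s1 bound_var 0 = B by rewrite (frame_rmem _ fr).
  split=> v; apply: (wp_leq (t := i * (d * 4 + 11) + d * 4 + 12)); last first.
    by rewrite !leq_add2r leq_mul2r ltnW ?orbT.
  rewrite -i_eval; apply: (wp_exec (dedup_step_spec inp1)) => s2 _.
  rewrite i_eval C_eval B_eval => row_eval; split=> // l.
  rewrite ltnS leq_eqVlt => lt_l; apply: etrans (row_eval l) _.
  by case: eqP lt_l => [->|_ /rows_eval].
by lia.
Qed.

End Output.

(** * Correctness of the program *)

Lemma nth_flatten_uniform (T : Type) (x0 : T) (ss : seq (seq T)) d i j :
  all (fun s => size s == d) ss -> (j < d)%N -> (i < size ss)%N ->
  nth x0 (flatten ss) (i * d + j) = nth x0 (nth [::] ss i) j.
Proof.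
move=> + lt_jd; elim: ss i => // s ss IH [|i] /= /andP[/eqP sz_s uniform] lt_i.
  by rewrite mul0n add0n nth_cat sz_s lt_jd.
by rewrite nth_cat sz_s mulSn -addnA ltnNge leq_addr /= addKn; apply: IH.
Qed.

Lemma input_init (R : realType) n d k (eps : R) (X : 'I_n -> 'rV[R]_d) :
  input k X eps (init_state k eps X).
Proof.
split=> //= x; apply/rowP => j; rewrite mxE /= nth_flatten_uniform //.
- rewrite (nth_map x) ?size_enum_ord // (nth_map j) ?size_enum_ord //.
  by rewrite !nth_ord_enum.
- by apply/allP => _ /mapP[p _ ->]; rewrite size_map size_enum_ord.
- by rewrite size_map size_enum_ord.
Qed.

Section NumberOfDraws.
Variables (R : realType) (eps : R) (k M : nat).
Hypotheses (eps_bnd : 0 < eps <= 2^-1) (k_gt0 : (0 < k)%N).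

Local Notation m := (number_of_draws k eps M).

Lemma ratio_ge1 i : 1 <= k%:R ^+ i / eps ^+ i.
Proof.
have /andP[eps_gt0 eps_le] := eps_bnd.
rewrite -expr_div_n exprn_ege1 // ler_pdivlMr // mul1r.
by apply: (@le_trans _ _ 1); [lra | rewrite ler1n].
Qed.

Lemma number_of_draws_le : m%:R <= M%:R * (k%:R ^+ 3 / eps ^+ 3).
Proof.
have /andP[eps_gt0 _] := eps_bnd; rewrite mulrA truncn_le.
by rewrite divr_ge0 ?mulr_ge0 ?exprn_ge0 // ltW.
Qed.

Lemma number_of_draws_ge (N : nat) :
  (N < M)%N -> N%:R * k%:R ^+ 3 <= m%:R * eps ^+ 3.
Proof.
move=> lt_NM; have /andP[eps_gt0 _] := eps_bnd.
rewrite -ler_pdivrMr ?exprn_gt0 // -mulrA -(lerD2r 1) natr1.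
apply: le_trans (ltW (truncnS_gt _)); rewrite -mulrA.
have := ratio_ge1 3; set r := _ / _ => r_ge1.
apply: (@le_trans _ _ (N.+1%:R * r)).
  by rewrite -natr1 mulrDl mul1r lerD2l.
by rewrite ler_wpM2r ?ler_nat // (le_trans ler01).
Qed.

Lemma number_of_draws_bound : m%:R + 1 <= (M + 1)%:R * (k%:R ^+ 7 / eps ^+ 4).
Proof.
have := number_of_draws_le; have := ratio_ge1 3; set r := _ / _ => r_ge1 m_le.
apply: (@le_trans _ _ ((M + 1)%:R * r)).
  by rewrite natrD mulrDl mul1r lerD.
have /andP[eps_gt0 eps_le] := eps_bnd.
have k_ge1 : 1 <= k%:R :> R by rewrite ler1n.
have -> : k%:R ^+ 7 / eps ^+ 4 = r * (k%:R ^+ 4 / eps).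
  by rewrite /r; field; rewrite gt_eqF.
rewrite ler_wpM2l // ler_peMr ?(le_trans ler01) // ler_pdivlMr // mul1r.
by apply: (@le_trans _ _ 1); [lra | rewrite exprn_ege1].
Qed.

End NumberOfDraws.

Lemma prog_time_le (n d k m : nat) : (0 < n)%N -> (0 < d)%N -> (0 < k)%N ->
  (prog_time n d k m <= 500 * (m + 1) * (n * d * k ^ 2))%N.
Proof.
case: n d k => // n [//|d] [//|k] _ _ _.
by rewrite /prog_time /seed_time /recovery_time /output_time; nia.
Qed.

Section TimeBounds.
Variables (R : realType) (eps : R) (n d k M : nat).
Hypotheses (eps_bnd : 0 < eps <= 2^-1).
Hypotheses (n_gt0 : (0 < n)%N) (d_gt0 : (0 < d)%N) (k_gt0 : (0 < k)%N).

Local Notation m := (number_of_draws k eps M).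

Lemma prog_time_bound : (prog_time n d k m)%:R <=
  (500 * (M + 1))%:R * ((n * d * k ^ 9)%:R / eps ^+ 4).
Proof.
apply: (@le_trans _ _ (500 * (m + 1) * (n * d * k ^ 2))%:R).
  by rewrite ler_nat prog_time_le.
have -> : (500 * (m + 1) * (n * d * k ^ 2))%:R =
    500 * (n%:R * d%:R * k%:R ^+ 2) * (m%:R + 1) :> R.
  by rewrite !(natrM, natrD, natrX); ring.
have -> : (500 * (M + 1))%:R * ((n * d * k ^ 9)%:R / eps ^+ 4) =
    500 * (n%:R * d%:R * k%:R ^+ 2) * ((M + 1)%:R * (k%:R ^+ 7 / eps ^+ 4)).
  by rewrite !(natrM, natrD, natrX); ring.
by rewrite ler_wpM2l ?number_of_draws_bound // !mulr_ge0 ?exprn_ge0.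
Qed.

Lemma query_bound : (m * k)%:R <= (500 * (M + 1))%:R * ((k ^ 9)%:R / eps ^+ 4).
Proof.
have /andP[eps_gt0 _] := eps_bnd; have k_ge1 : 1 <= k%:R :> R by rewrite ler1n.
set B := (M + 1)%:R * (k%:R ^+ 7 / eps ^+ 4).
have B_ge0 : 0 <= B by rewrite mulr_ge0 // divr_ge0 // ?exprn_ge0 // ltW.
have m_le : m%:R <= B.
  by apply: le_trans (number_of_draws_bound M eps_bnd k_gt0); rewrite lerDl.
have -> : (500 * (M + 1))%:R * ((k ^ 9)%:R / eps ^+ 4) = 500 * k%:R * B * k%:R.
  by rewrite /B !(natrM, natrX); ring.
rewrite natrM ler_wpM2r // (le_trans m_le) // ler_peMl //; lra.
Qed.

End TimeBounds.

Lemma wp_achieves (R : realType) orc (Q E : state R -> Prop) t c s v :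
  wp orc Q E t c s v (fun s' v' => Q s' /\ v' <= `[< E s' >]%:R) ->
  achieves orc Q E t ([:: c], s) v.
Proof.
move=> wp_c; rewrite -[t]addn0.
by apply: (run_wp wp_c) => s' v' _ [Qs' v'_le]; split.
Qed.

Section Correctness.
Variables (R : realType) (n d k M : nat) (X : 'I_n -> 'rV[R]_d) (eps : R).
Variables (f : 'I_n -> 'I_k) (c : 'I_k -> 'rV[R]_d) (i0 : 'I_n).
Variables (Q E : state R -> Prop).
Hypothesis i0_eq0 : val i0 = 0.
Hypothesis d_gt0 : (0 < d)%N.
Hypothesis k_gt0 : (0 < k)%N.
Hypothesis eps_bnd : 0 < eps <= 2^-1.

Local Notation m := (number_of_draws k eps M).
Implicit Types (s : state R) (w : 'I_n -> R) (xs : seq 'I_n) (b : 'I_n -> 'I_n).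

Local Notation input := (input k X eps).

Definition output_ok w xs s : Prop :=
  uniq (output d k s) /\
  forall j, has (fun x => f x == j) xs ->
    weighted_mean X f w xs j \in output d k s.

Lemma output_spec w xs s : input s -> slot_sums X f w xs s ->
  exec (oracle f) Q E (output_time d k) (Seq means_cmd dedup_cmd) s
    (output_ok w xs).
Proof.
move=> inp [mass_eval moment_eval]; split=> v; apply: wp_seq.
apply: (wp_exec (means_spec _ _ _ d_gt0 inp)) => s1 fr1 [mean_eval bound_eval].
have inp1 := input_frame fr1 isT inp.
apply: (wp_exec (dedup_spec _ _ _ d_gt0 inp1)) => s2 _ center_eval; split=> //.
have outputE : output d k s2 =
    [seq dedup d_gt0 (mem_row d mean_arr s1) (rmem s1 bound_var 0) l
      | l : 'I_k].
  by apply: eq_map => l; rewrite -center_eval.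
rewrite /output_ok outputE; split=> [|j j_seen].
  apply: dedup_uniq => i lt_ik; rewrite mean_eval // bound_eval.
  exact: (lt_sum_sqr (fun l => slot_mean d s l 0 (Ordinal d_gt0))).
have lt_jk : (index j (labels f xs) < k)%N.
  apply: leq_trans (nslots_le f xs); rewrite index_mem mem_first_seen.
  by have /hasP[x x_in /eqP <-] := j_seen; apply: map_f.
have := mem_dedup d_gt0 (mem_row d mean_arr s1) (rmem s1 bound_var 0) lt_jk.
by rewrite mean_eval // /slot_mean mass_eval moment_eval !sum_slot_label.
Qed.

Lemma recovery_phase_spec w s (h : seq 'I_n -> R) Post :
  (forall x, 0 < w x) -> input s ->
  (forall x : 'I_n, rmem s weight_arr x = w x) ->
  imem s ndraws_var 0 = 0 -> slot_table f [::] s -> slot_sums X f w [::] s ->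
  (forall s' xs, output_ok w xs s' -> (nqueries s' <= nqueries s + m * k)%N ->
     Post s' (h xs)) ->
  wp (oracle f) Q E (recovery_time n d k m)
    (Seq (count_cmd M) (Seq recover_cmd (Seq means_cmd dedup_cmd))) s
    (iid_expect (sample_law i0 w) m h [::]) Post.
Proof.
move=> w_gt0 inp weight_eval draws0 table sums post.
have /andP[eps_gt0 _] := eps_bnd; apply: wp_seq.
apply: (wp_exec (count_spec _ _ _ M eps_gt0 inp draws0)) => s1 fr1 m_eval.
have inp1 := input_frame fr1 isT inp.
apply: wp_seq; apply: wp_frame.
apply: (recover_spec _ _ i0_eq0 w_gt0 inp1) => //.
- by move=> x; rewrite (frame_rmem _ fr1).
- exact: slot_table_frame fr1 isT isT table.
- exact: slot_sums_frame fr1 isT isT sums.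
move=> s2 xs sz_xs _ sums2 q_le fr2; have inp2 := input_frame fr2 isT inp1.
apply: (wp_exec (output_spec inp2 sums2)) => s3 fr3 out_ok; apply: post => //.
by rewrite (frame_queries fr3 isT) -(frame_queries fr1 isT).
Qed.

Lemma prog_spec (h : ('I_n -> 'I_n) -> seq 'I_n -> R) Post :
  let s := init_state k eps X in
  (forall s' b xs, output_ok (anchor_weight X b) xs s' ->
     (nqueries s' <= m * k)%N -> Post s' (h b xs)) ->
  wp (oracle f) Q E (prog_time n d k m) (prog M) s
    (seeding_expect X i0 (8 * k) (fun b =>
       iid_expect (sample_law i0 (anchor_weight X b)) m (h b) [::])) Post.
Proof.
move=> s post; have inp : input s := input_init k eps X.
apply: wp_seq; apply: wp_frame.
apply: (seed_spec _ _ _ i0_eq0 inp) => // s1 us b _ b_s1 fr1.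
have inp1 := input_frame fr1 isT inp.
apply: wp_seq; apply: (wp_exec (cells_spec _ _ _ inp1 b_s1 _ _)).
- by rewrite (frame_rmem _ fr1).
- by move=> p; rewrite (frame_imem _ fr1).
move=> s2 fr2 [cost_eval cell_eval]; have inp2 := input_frame fr2 isT inp1.
have b_s2 := anchors_frame fr2 isT isT b_s1.
apply: wp_seq.
apply: (wp_exec (weigh_spec _ _ _ inp2 b_s2 cost_eval cell_eval)).
move=> s3 fr3 weight_eval; have inp3 := input_frame fr3 isT inp2.
have imem3 a i : a \notin iwrites (Seq seed_cmd (Seq cells_cmd weigh_cmd)) ->
    imem s3 a i = imem s a i.
  by move/frame_imem; apply; apply: frame_seq fr1 (frame_seq fr2 fr3).
have rmem3 a i : a \notin rwrites (Seq seed_cmd (Seq cells_cmd weigh_cmd)) ->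
    rmem s3 a i = rmem s a i.
  by move/frame_rmem; apply; apply: frame_seq fr1 (frame_seq fr2 fr3).
apply: recovery_phase_spec => //.
- by move=> x; apply: anchor_weight_gt0.
- by rewrite imem3.
- by split=> //; rewrite imem3.
- split=> l; rewrite big_nil; first by rewrite rmem3.
  by apply/rowP => j; rewrite !mxE rmem3.
move=> s4 xs out_ok; rewrite (frame_queries fr3 isT) (frame_queries fr2 isT).
by rewrite (frame_queries fr1 isT); apply: post.
Qed.

Hypothesis voronoi : forall i l, sqdist (X i) (c (f i)) <= sqdist (X i) (c l).
Hypothesis M_gt : (5 * 10 ^ 6 < M)%N.

Lemma success_probability :
  4^-1 <= seeding_expect X i0 (8 * k) (fun b =>
    iid_expect (sample_law i0 (anchor_weight X b)) m
      (fun xs => `[< recovered X f c b eps xs >]%:R) [::]) :> R.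
Proof.
have card_k : (0 < #|'I_k|)%N by rewrite card_ord.
set rate := fun b => iid_expect _ _ _ _.
have rate_ge0 b : 0 <= rate b.
  apply: chain_expect_ge0 => // _ a; apply: sample_law_ge0 => x.
  by rewrite ltW // anchor_weight_gt0.
have half_ge0 : 0 <= 2^-1 :> R by rewrite invr_ge0.
apply: (@le_trans _ _ (2^-1 / 2)); first lra.
rewrite -[in leRHS](card_ord k).
apply: (seeding_success (f := f) (c := c) half_ge0 card_k rate_ge0).
move=> us b sz_us cost_le.
apply: (recovery i0 voronoi eps_bnd card_k (anchors := i0 :: us)) => //.
- exact: (foldl_add_anchor_mem X (fun=> i0)).
- by rewrite /= sz_us.
have := number_of_draws_ge eps_bnd k_gt0 M_gt.
by rewrite card_ord natrM natrX.
Qed.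

End Correctness.

Theorem theorem7 (R : realType) :
  exists (P : cmd) (a : nat),
  forall (eps : R) (k n d : nat) (X : 'I_n -> 'rV[R]_d) (f : 'I_n -> 'I_k),
    0 < eps <= 2^-1 -> (0 < k)%N -> (0 < n)%N -> (0 < d)%N ->
    injective X -> optimal_clustering X f ->
    exists T : nat,
      [/\ T%:R <= a%:R * ((n * d * k ^ 9)%:R / eps ^+ 4),
          always (oracle f) T ([:: P], init_state k eps X)
            (fun s => (nqueries s)%:R <= a%:R * ((k ^ 9)%:R / eps ^+ 4))
        & 4^-1 <= Pr (oracle f) T ([:: P], init_state k eps X)
            (fun s => let C := output d k s in
               [/\ uniq C, size C = k &
                   Phi C X <= (1 + eps) * Delta k X])].
Proof.
have [M M_gt] : exists M, (5 * 10 ^ 6 < M)%N.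
  by exists (5 * 10 ^ 6).+1; exact: ltnSn.
exists (prog M), (500 * (M + 1))%N.
move=> eps k n d X f eps_bnd k_gt0 n_gt0 d_gt0 _ [c [_ opt voronoi]].
rewrite -opt (Phi_optimal voronoi).
pose i0 := Ordinal n_gt0.
pose T := prog_time n d k (number_of_draws k eps M); exists T.
set few_queries := (X in always _ _ _ X); set success := (X in Pr _ _ _ X).
suff [halts Pr_ge] : achieves (oracle f) few_queries success T
    ([:: prog M], init_state k eps X) 4^-1.
  by split=> //; apply: prog_time_bound.
apply: achieves_le (success_probability i0 k_gt0 eps_bnd voronoi M_gt) _.
apply: wp_achieves.
apply: prog_spec => // s b xs [out_uniq out_means] q_le; split.
  by apply: le_trans (query_bound M eps_bnd k_gt0); rewrite ler_nat.
have out_size : size (output d k s) = k by rewrite size_map size_enum_ord.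
rewrite ler_nat; case: asboolP => // rec; rewrite asboolT //; split=> //.
by apply: rec => //; rewrite -size_eq0 out_size -lt0n.
Qed.
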